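(* Let $G$ be a subgroup of $\mathbf V(r,\mathbb R^*_+,\mathbb R)$ such that $G\cap \mathbf F(r,\mathbb R^*_+,\mathbb R)=\mathbf F(r,\Lambda,A)$. Then the group $G$ interprets the Arithmetic $(\mathbb N,+,\times)$ with parameters.
   Context: Maps act on the right: $(\alpha)x$ is the image of $\alpha$ under $x$, and $xy$ means ''first $x$, then $y$''. Fix a real $r>0$, a subgroup $\Lambda\neq\{1\}$ of the multiplicative group $\mathbb R^*_+$ of positive reals, and an additive subgroup $A\subseteq\mathbb R$ with $r\in A$ and $\lambda A\subseteq A$ for all $\lambda\in\Lambda$ (the same definitions are also used with $\Lambda=\mathbb R^*_+$, $A=\mathbb R$). $\mathbf V(r,\Lambda,A)$ is the group of all bijections $x\colon[0,r)\to[0,r)$ such that: $x$ is piecewise affine with finitely many breakpoints and discontinuity points; $x$ is right-continuous at every point; the slope of each affine piece lies in $\Lambda$; all breakpoints and discontinuity points of $x$, and their images, lie in $A$. $\mathbf F(r,\Lambda,A)$ is the subgroup of elements of $\mathbf V(r,\Lambda,A)$ continuous for the usual topology of $[0,r)$. Groups are viewed as first-order structures in the language with one binary function symbol (multiplication). An interpretation with parameters of a structure $M$ in a structure $N$ is a pair $(n,f)$ with $n\in\mathbb N$ and $f$ a surjection from a subset of $N^n$ onto $M$ such that for every subset $X\subseteq M^k$ definable in $M$ without parameters, the preimage of $X$ under the coordinatewise map $f^{\underline k}$ is first-order definable in $N$ with parameters from $N$; it is an interpretation without parameters if all these preimages are definable without parameters. (Equivalently: the domain of $f$, the kernel equivalence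 relation of $f$, and the preimages of the graphs of all basic relations, operations and constants of $M$ are definable, resp. definable without parameters.) *)

(* Defs.v *)
From Stdlib Require Import Reals List Arith.
Import ListNotations.
Open Scope R_scope.

Inductive term (F : Type) : Type :=
  | TVar : nat -> term F
  | TApp : F -> term F -> term F -> term F.
Arguments TVar {F} _.
Arguments TApp {F} _ _ _.

Inductive formula (F : Type) : Type :=
  | FEq  : term F -> term F -> formula F
  | FNot : formula F -> formula F
  | FAnd : formula F -> formula F -> formula F
  | FEx  : nat -> formula F -> formula F.
Arguments FEq {F} _ _.
Arguments FNot {F} _.
Arguments FAnd {F} _ _.
Arguments FEx {F} _ _.

Fixpoint term_has_var {F : Type} (v : nat) (t : term F) : Prop :=
  match t with
  | TVar n => n = v
  | TApp _ t1 t2 => term_has_var v t1 \/ term_has_var v t2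
  end.

Fixpoint is_free {F : Type} (v : nat) (phi : formula F) : Prop :=
  match phi with
  | FEq t1 t2 => term_has_var v t1 \/ term_has_var v t2
  | FNot p => is_free v p
  | FAnd p q => is_free v p \/ is_free v q
  | FEx k p => v <> k /\ is_free v p
  end.

Definition fv_bound {F : Type} (m : nat) (phi : formula F) : Prop :=
  forall v, is_free v phi -> (v < m)%nat.

Fixpoint eval_term {F M : Type} (op : F -> M -> M -> M) (e : nat -> M)
    (t : term F) : M :=
  match t with
  | TVar n => e n
  | TApp f t1 t2 => op f (eval_term op e t1) (eval_term op e t2)
  end.

Definition upd {M : Type} (e : nat -> M) (k : nat) (a : M) : nat -> M :=
  fun i => if Nat.eqb i k then a else e i.

Fixpoint sat {F M : Type} (dom : M -> Prop) (op : F -> M -> M -> M)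
    (e : nat -> M) (phi : formula F) : Prop :=
  match phi with
  | FEq t1 t2 => eval_term op e t1 = eval_term op e t2
  | FNot p => ~ sat dom op e p
  | FAnd p q => sat dom op e p /\ sat dom op e q
  | FEx k p => exists a, dom a /\ sat dom op (upd e k a) p
  end.

Definition env_of {M : Type} (d : M) (l : list M) : nat -> M :=
  fun i => nth i l d.

(* X ⊆ M^m (tuples = lists of length m with entries in dom) is definable
   with parameters: variables 0..m-1 are the tuple, variables m..m+|p|-1
   are the parameters p. *)
Definition definable_params {F M : Type} (dom : M -> Prop)
    (op : F -> M -> M -> M) (d : M) (m : nat) (X : list M -> Prop) : Prop :=
  exists (phi : formula F) (p : list M),
    Forall dom p /\ fv_bound (m + length p) phi /\
    forall w, length w = m -> Forall dom w ->
      (X w <-> sat dom op (env_of d (w ++ p)) phi).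

Definition definable_noparams {F M : Type} (dom : M -> Prop)
    (op : F -> M -> M -> M) (d : M) (m : nat) (X : list M -> Prop) : Prop :=
  exists (phi : formula F),
    fv_bound m phi /\
    forall w, length w = m -> Forall dom w ->
      (X w <-> sat dom op (env_of d w) phi).

(* Interpretation with parameters of the structure (M, domM, opM) in the
   structure (N, domN, opN): a pair (n, f), f a surjection from a subset D
   of N^n onto domM, such that for every k and every X ⊆ M^k definable in M
   without parameters, the preimage (f^k)^{-1}(X) ⊆ N^(n k) is definable in
   N with parameters.  An (n k)-tuple is the concatenation of k n-tuples. *)
Definition interprets_with_params {FN FM N M : Type}
    (domN : N -> Prop) (opN : FN -> N -> N -> N) (dN : N)
    (domM : M -> Prop) (opM : FM -> M -> M -> M) (dM : M) : Prop :=
  exists (n : nat) (D : list N -> Prop) (f : list N -> M),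
    (forall w, D w -> length w = n /\ Forall domN w) /\
    (forall w, D w -> domM (f w)) /\
    (forall a, domM a -> exists w, D w /\ f w = a) /\
    forall (k : nat) (X : list M -> Prop),
      definable_noparams domM opM dM k X ->
      definable_params domN opN dN (n * k)
        (fun w => exists ws : list (list N),
            length ws = k /\ concat ws = w /\ Forall D ws /\ X (map f ws)).

Inductive arith_sym : Type := SPlus | STimes.

Definition arith_op (s : arith_sym) (a b : nat) : nat :=
  match s with SPlus => (a + b)%nat | STimes => (a * b)%nat end.

(* Elements are represented as maps R -> R which are the identity outside
   [0, r); their restriction to [0, r) is the actual bijection. *)

Definition in_I (r t : R) : Prop := 0 <= t < r.

Definition isV (r : R) (Lam A : R -> Prop) (x : R -> R) : Prop :=
  (forall t, ~ in_I r t -> x t = t) /\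
  (forall t, in_I r t -> in_I r (x t)) /\
  (forall s, in_I r s -> exists t, in_I r t /\ x t = s) /\
  (forall s t, in_I r s -> in_I r t -> x s = x t -> s = t) /\
  (* finite subdivision 0 = a_0 < a_1 < ... < a_k = r containing all
     breakpoints and discontinuity points; x is affine with slope in Lam on
     each [a_i, a_{i+1}) (hence right-continuous); the a_i and x(a_i) lie
     in A *)
  exists (k : nat) (a : nat -> R),
    a 0%nat = 0 /\ a k = r /\
    (forall i, (i < k)%nat -> a i < a (S i)) /\
    (forall i, (i < k)%nat ->
        A (a i) /\ A (x (a i)) /\
        exists lam b, Lam lam /\
          forall t, a i <= t < a (S i) -> x t = lam * t + b).

Definition cont_on_I (r : R) (x : R -> R) : Prop :=
  forall t, in_I r t -> forall eps, eps > 0 ->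
    exists delta, delta > 0 /\
      forall s, in_I r s -> Rabs (s - t) < delta -> Rabs (x s - x t) < eps.

Definition isF (r : R) (Lam A : R -> Prop) (x : R -> R) : Prop :=
  isV r Lam A x /\ cont_on_I r x.

Definition allPos (l : R) : Prop := 0 < l.
Definition allR (a : R) : Prop := True.

(* group law with maps acting on the right: xy = "first x, then y" *)
Inductive grp_sym : Type := SMul.
Definition grp_op (_ : grp_sym) (x y : R -> R) : R -> R := fun t => y (x t).

Definition idR : R -> R := fun t => t.

Definition is_subgroup_of_V (r : R) (G : (R -> R) -> Prop) : Prop :=
  (forall x, G x -> isV r allPos allR x) /\
  G idR /\
  (forall x y, G x -> G y -> G (grp_op SMul x y)) /\
  (forall x, G x -> exists y, G y /\ grp_op SMul x y = idR /\ grp_op SMul y x = idR).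

(* Main.v *)
Require Import Defs.
From Stdlib Require Import Reals List Arith Lra Lia FunctionalExtensionality ClassicalEpsilon.
Import ListNotations.
Open Scope R_scope.

(** Take in [F(r, Lam, A)] an element [t] with [t x > x] on [(0, r)], of slope
    [l > 1] at [0] and [l^-2] at [r]. Its centralizer in [G] is [{t^n}]:
    a commuting element is determined by its slope at [0], which can be brought
    into [[1, l)] by a power of [t], and a slope strictly between [1] and [l] would
    force different slopes arbitrarily close to [r]. The natural number [n] is
    coded by [T^n], [T = t^-1]; negative exponents are excluded by asking that the
    conjugate by [T^n] of some [c], supported in an interval [J] with
    [J], [t J], [t^2 J], ... disjoint, commute with some [s], which is the identity
    up to [J] and coincides with [t] from [t J] on. Composition is addition.
    Finally [m = k n] holds iff some [b] in [G] commutes with [c] and conjugates the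
    copies of [c] on [J], [T J], ..., [T^k J] to copies whose indices grow by [n + 1]
    at each step, ending at [k + m]; for [m = k n] a product of conjugates of
    [s t^-1] is such a [b]. *)

(** * Piecewise affine bumps *)

(** Increasing bijections of the whole line, with the inverse carried along so that maxima and
    minima of such maps can be inverted by a formula. *)
Definition inverse_pair (f f' : R -> R) : Prop :=
  (forall x y, x < y -> f x < f y) /\ (forall x y, x < y -> f' x < f' y) /\
  (forall x, f' (f x) = x) /\ (forall y, f (f' y) = y).

Lemma incr_le (f : R -> R) :
  (forall x y, x < y -> f x < f y) -> forall x y, x <= y -> f x <= f y.
Proof.
  intros Hf x y [H | ->]; [left; auto | right; reflexivity].
Qed.

Lemma inverse_pair_sym f f' : inverse_pair f f' -> inverse_pair f' f.
Proof. unfold inverse_pair; tauto. Qed.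

Lemma inverse_pair_id : inverse_pair (fun x => x) (fun x => x).
Proof. repeat split; auto. Qed.

Lemma inverse_pair_affine k p q :
  0 < k -> inverse_pair (fun x => q + k * (x - p)) (fun y => p + / k * (y - q)).
Proof.
  intros hk. assert (h := Rinv_0_lt_compat _ hk).
  repeat split; intros; try nra; field; lra.
Qed.

(** As [f] and [g] increase, [Rmax (f x) (g x) <= y] means [x <= f' y] and [x <= g' y]; so the
    minimum of the inverses inverts the maximum. *)
Lemma inverse_pair_max f f' g g' :
  inverse_pair f f' -> inverse_pair g g' ->
  inverse_pair (fun x => Rmax (f x) (g x)) (fun y => Rmin (f' y) (g' y)).
Proof.
  intros (F1 & F2 & F3 & F4) (G1 & G2 & G3 & G4).
  assert (F1' := incr_le _ F1). assert (G1' := incr_le _ G1).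
  assert (F2' := incr_le _ F2). assert (G2' := incr_le _ G2).
  repeat split; intros.
  - specialize (F1 _ _ H); specialize (G1 _ _ H).
    unfold Rmax; repeat destruct Rle_dec; lra.
  - specialize (F2 _ _ H); specialize (G2 _ _ H).
    unfold Rmin; repeat destruct Rle_dec; lra.
  - unfold Rmax; destruct (Rle_dec (f x) (g x)) as [h|h].
    + rewrite G3. apply Rmin_right. rewrite <- (F3 x) at 1. auto.
    + rewrite F3. apply Rmin_left. rewrite <- (G3 x) at 1. apply G2'. lra.
  - unfold Rmin; destruct (Rle_dec (f' y) (g' y)) as [h|h].
    + rewrite F4. apply Rmax_left. rewrite <- (G4 y) at 2. auto.
    + rewrite G4. apply Rmax_right. rewrite <- (F4 y) at 2. apply F1'. lra.
Qed.

Lemma inverse_pair_min f f' g g' :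
  inverse_pair f f' -> inverse_pair g g' ->
  inverse_pair (fun x => Rmin (f x) (g x)) (fun y => Rmax (f' y) (g' y)).
Proof.
  intros Hf Hg. apply inverse_pair_sym.
  apply inverse_pair_max; apply inverse_pair_sym; assumption.
Qed.

Definition lipschitz (L : R) (f : R -> R) : Prop :=
  forall x y, x <= y -> f y - f x <= L * (y - x).

Lemma lipschitz_max L f g :
  lipschitz L f -> lipschitz L g -> lipschitz L (fun x => Rmax (f x) (g x)).
Proof.
  intros Hf Hg x y h. specialize (Hf x y h); specialize (Hg x y h).
  unfold Rmax; repeat destruct Rle_dec; lra.
Qed.

Lemma lipschitz_min L f g :
  lipschitz L f -> lipschitz L g -> lipschitz L (fun x => Rmin (f x) (g x)).
Proof.
  intros Hf Hg x y h. specialize (Hf x y h); specialize (Hg x y h).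
  unfold Rmin; repeat destruct Rle_dec; lra.
Qed.

(** The last clause of [isV] with the end point [r] replaced by a variable [v], so that a
    subdivision can be built piece by piece. *)
Definition affine_up_to (Lam A : R -> Prop) (x : R -> R) (v : R) : Prop :=
  exists (k : nat) (a : nat -> R),
    a 0%nat = 0 /\ a k = v /\
    (forall i, (i < k)%nat -> a i < a (S i)) /\
    (forall i, (i < k)%nat ->
        A (a i) /\ A (x (a i)) /\
        exists lam b, Lam lam /\
          forall t, a i <= t < a (S i) -> x t = lam * t + b).

Lemma affine_up_to_0 Lam A x : affine_up_to Lam A x 0.
Proof. exists 0%nat, (fun _ => 0). repeat split; auto; lia. Qed.

(* Allowing [u = v] makes degenerate pieces harmless. *)
Lemma affine_up_to_step (Lam A : R -> Prop) x u v lam b :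
  affine_up_to Lam A x u -> u <= v -> A u -> A (x u) -> Lam lam ->
  (forall t, u <= t < v -> x t = lam * t + b) -> affine_up_to Lam A x v.
Proof.
  intros (k & a & h0 & hk & hs & hp) [huv | <-] hu hxu hl hx;
    [|exists k, a; exact (conj h0 (conj hk (conj hs hp)))].
  assert (E : forall i, (i <= k)%nat -> (if (i <=? k)%nat then a i else v) = a i).
  { intros i hi. rewrite (proj2 (Nat.leb_le i k) hi). reflexivity. }
  assert (E' : (if (S k <=? k)%nat then a (S k) else v) = v).
  { rewrite (proj2 (Nat.leb_gt (S k) k)); auto. }
  exists (S k), (fun i => if (i <=? k)%nat then a i else v).
  split; [rewrite E; auto; lia|]. split; [exact E'|].
  split; intros i hi; rewrite (E i) by lia;
    (destruct (Nat.eq_dec i k) as [-> | hne];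
      [rewrite E', hk | rewrite (E (S i)) by lia]).
  - exact huv.
  - apply hs; lia.
  - repeat split; auto. exists lam, b. auto.
  - apply hp; lia.
Qed.

(** An increasing bijection of the line fixing [0] and [r] preserves [[0, r)]; it fixes [r] because
    [r] lies outside [[0, r)]. Continuity comes from the Lipschitz bound. *)
Lemma isF_of_inverse_pair r Lam A L x x' :
  0 <= L -> inverse_pair x x' -> lipschitz L x ->
  (forall t, ~ in_I r t -> x t = t) -> x 0 = 0 ->
  affine_up_to Lam A x r -> isF r Lam A x.
Proof.
  intros hL (h1 & h2 & h3 & h4) hlip hid h0 haff.
  assert (hr : x r = r) by (apply hid; unfold in_I; lra).
  split; [split; [exact hid|split; [|split; [|split; [|exact haff]]]]|].
  - intros t [ht ht']. split; [rewrite <- h0; apply incr_le; auto|].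
    rewrite <- hr; auto.
  - intros s [hs hs']. exists (x' s). split; [|auto].
    split.
    + rewrite <- (h3 0), h0. apply incr_le; auto.
    + rewrite <- (h3 r), hr. auto.
  - intros s t _ _ e. rewrite <- (h3 s), <- (h3 t), e. reflexivity.
  (* Dividing by [L + 1] covers the case [L = 0]. *)
  - intros t _ eps he. exists (eps / (L + 1)).
    split; [apply Rdiv_lt_0_compat; lra|].
    intros s _ hd.
    assert (hd' : (L + 1) * Rabs (s - t) < eps).
    { apply (Rmult_lt_compat_l (L + 1)) in hd; [|lra].
      replace ((L + 1) * (eps / (L + 1))) with eps in hd by (field; lra). exact hd. }
    assert (Hm := incr_le _ h1).
    destruct (Rle_dec s t) as [hle | hle].
    + specialize (hlip s t hle). specialize (Hm s t hle).
      rewrite (Rabs_left1 (s - t)) in hd' by lra.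
      rewrite Rabs_left1 by lra. nra.
    + assert (hle' : t <= s) by lra.
      specialize (hlip t s hle'). specialize (Hm t s hle').
      rewrite (Rabs_right (s - t)) in hd' by lra.
      rewrite Rabs_right by lra. nra.
Qed.

(* The max/min form makes monotonicity and bijectivity formal. When there is room
   in [[u, v]], this is the identity off [[u, v]], of slope [l] on
   [[u, u + (l + 1) al]], a translation by [(l^2 - 1) al] in the middle, and of slope
   [l^-2] on [[v - l^2 al, v]]; the different slopes at the two ends are what makes the
   centralizer cyclic. *)
Definition bump (l u v al x : R) : R :=
  Rmax x (Rmin (u + l * (x - u))
            (Rmin ((l ^ 2 - 1) * al + 1 * (x - 0)) (v + / l ^ 2 * (x - v)))).

Section Bump.

Variables l u v al : R.
Hypothesis hl : 1 < l.
Hypothesis hal : 0 < al.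
Hypothesis hroom : (l ^ 2 + l + 1) * al <= v - u.

Local Notation h := (bump l u v al).

Lemma inv_sq : 0 < / l ^ 2 < 1 /\ / l ^ 2 * l ^ 2 = 1.
Proof.
  assert (0 < / l ^ 2) by (apply Rinv_0_lt_compat; nra).
  assert (/ l ^ 2 * l ^ 2 = 1) by (field; lra).
  repeat split; auto; nra.
Qed.

Lemma bump_left x : x <= u -> h x = x.
Proof.
  intros hx. apply Rmax_left. eapply Rle_trans; [apply Rmin_l|]. nra.
Qed.

Lemma bump_right x : v <= x -> h x = x.
Proof.
  intros hx. destruct inv_sq as [h1 h2]. apply Rmax_left.
  eapply Rle_trans; [apply Rmin_r|]. eapply Rle_trans; [apply Rmin_r|]. nra.
Qed.

Lemma bump_slope_l x : u <= x <= u + (l + 1) * al -> h x = u + l * (x - u).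
Proof.
  intros hx. destruct inv_sq as [h1 h2]. unfold bump.
  (* The first affine piece lies below the last one at [x], after multiplication by [l ^ 2]. *)
  assert (H : l * (x - u) * l ^ 2 + (v - x) <= (v - u) * l ^ 2).
  { assert ((l ^ 2 + l + 1) * (x - u) <= (l + 1) * (v - u)).
    { apply Rle_trans with ((l + 1) * ((l ^ 2 + l + 1) * al)); [|nra].
      replace ((l + 1) * ((l ^ 2 + l + 1) * al)) with
        ((l ^ 2 + l + 1) * ((l + 1) * al)) by ring.
      apply Rmult_le_compat_l; nra. }
    assert ((l - 1) * ((l ^ 2 + l + 1) * (x - u)) <= (l - 1) * ((l + 1) * (v - u)))
      by (apply Rmult_le_compat_l; lra).
    nra. }
  rewrite (Rmin_left (u + _)).
  - apply Rmax_right. nra.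
  - apply Rmin_glb; [nra|].
    apply Rmult_le_reg_r with (l ^ 2); [nra|].
    replace ((v + / l ^ 2 * (x - v)) * l ^ 2) with
      (v * l ^ 2 + (/ l ^ 2 * l ^ 2) * (x - v)) by ring.
    rewrite h2. nra.
Qed.

Lemma bump_translation x :
  u + (l + 1) * al <= x <= v - l ^ 2 * al -> h x = x + (l ^ 2 - 1) * al.
Proof.
  intros hx. destruct inv_sq as [h1 h2]. unfold bump.
  assert (0 < (l ^ 2 - 1) * al) by (apply Rmult_lt_0_compat; nra).
  rewrite (Rmin_left (_ * al + _)), (Rmin_right (u + _)).
  - rewrite Rmax_right; lra.
  - assert ((l - 1) * ((l + 1) * al) <= (l - 1) * (x - u))
      by (apply Rmult_le_compat_l; lra). nra.
  - apply Rmult_le_reg_r with (l ^ 2); [nra|].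
    replace ((v + / l ^ 2 * (x - v)) * l ^ 2) with
      (v * l ^ 2 + (/ l ^ 2 * l ^ 2) * (x - v)) by ring.
    rewrite h2.
    assert ((l ^ 2 - 1) * (l ^ 2 * al) <= (l ^ 2 - 1) * (v - x))
      by (apply Rmult_le_compat_l; nra). nra.
Qed.

Lemma bump_slope_r x : v - l ^ 2 * al <= x <= v -> h x = v + / l ^ 2 * (x - v).
Proof.
  intros hx. destruct inv_sq as [h1 h2]. unfold bump.
  assert (H0 : (v - x) * (l ^ 3 - 1) <= (v - u) * (l ^ 3 - l ^ 2)).
  { assert ((l ^ 2 + l + 1) * (v - x) <= l ^ 2 * (v - u)).
    { apply Rle_trans with (l ^ 2 * ((l ^ 2 + l + 1) * al)); [|nra].
      replace (l ^ 2 * ((l ^ 2 + l + 1) * al)) with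
        ((l ^ 2 + l + 1) * (l ^ 2 * al)) by ring.
      apply Rmult_le_compat_l; nra. }
    assert ((l - 1) * ((l ^ 2 + l + 1) * (v - x)) <= (l - 1) * (l ^ 2 * (v - u)))
      by (apply Rmult_le_compat_l; lra).
    nra. }
  assert (E : (v + / l ^ 2 * (x - v)) * l ^ 2 = v * l ^ 2 + (x - v)).
  { replace ((v + / l ^ 2 * (x - v)) * l ^ 2) with
      (v * l ^ 2 + (/ l ^ 2 * l ^ 2) * (x - v)) by ring. rewrite h2. ring. }
  rewrite (Rmin_right (_ * al + _)), (Rmin_right (u + _)).
  - apply Rmax_right. nra.
  - apply Rmult_le_reg_r with (l ^ 2); [nra|]. rewrite E. nra.
  - apply Rmult_le_reg_r with (l ^ 2); [nra|]. rewrite E.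
    assert ((l ^ 2 - 1) * (v - x) <= (l ^ 2 - 1) * (l ^ 2 * al))
      by (apply Rmult_le_compat_l; nra). nra.
Qed.

Lemma bump_inverse_pair : exists h', inverse_pair h h'.
Proof.
  destruct inv_sq as [h1 h2].
  assert (P1 := inverse_pair_affine l u u ltac:(lra)).
  assert (P2 := inverse_pair_affine 1 0 ((l ^ 2 - 1) * al) ltac:(lra)).
  assert (P3 := inverse_pair_affine (/ l ^ 2) v v ltac:(lra)).
  eexists. unfold bump.
  apply inverse_pair_max; [apply inverse_pair_id|].
  apply inverse_pair_min; [exact P1|]. apply inverse_pair_min; [exact P2|exact P3].
Qed.

Lemma bump_lipschitz : lipschitz l h.
Proof.
  destruct inv_sq as [h1 h2]. unfold bump.
  apply lipschitz_max; [intros x y hxy; nra|].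
  apply lipschitz_min; [intros x y hxy; nra|].
  apply lipschitz_min; intros x y hxy; nra.
Qed.

Lemma bump_isF r (Lam A : R -> Prop) :
  (forall m n, Lam m -> Lam n -> Lam (m * n)) -> (forall m, Lam m -> Lam (/ m)) ->
  (forall x y, A x -> A y -> A (x + y)) -> (forall x, A x -> A (- x)) ->
  (forall m x, Lam m -> A x -> A (m * x)) ->
  Lam 1 -> Lam l -> A 0 -> A u -> A v -> A al -> 0 <= u -> v <= r ->
  isF r Lam A h.
Proof.
  intros Lmul Linv Aadd Aopp ALam L1 Ll A0 Au Av Aal hu hv.
  destruct bump_inverse_pair as [h' hh'].
  assert (Ll2 : Lam (l ^ 2)) by (simpl; rewrite Rmult_1_r; auto).
  assert (Asub : forall x y, A x -> A y -> A (x - y)) by (intros; apply Aadd; auto).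
  assert (Aa : A ((l + 1) * al)).
  { rewrite Rmult_plus_distr_r, Rmult_1_l. auto. }
  assert (Hla : 0 < (l + 1) * al) by nra.
  assert (Hlb : 0 < l ^ 2 * al) by (apply Rmult_lt_0_compat; nra).
  assert (hi := inv_sq).
  apply isF_of_inverse_pair with l h'; auto using bump_lipschitz.
  - lra.
  - intros t ht. destruct (Rle_dec t u); [apply bump_left; lra|].
    apply bump_right. unfold in_I in ht. lra.
  - apply bump_left. lra.
  (* The pieces are peeled off from the right, with cut points [v], [v - l ^ 2 * al],
     [u + (l + 1) * al] and [u]. *)
  - apply affine_up_to_step with v 1 0; [|lra|auto| |auto|].
    + apply affine_up_to_step with (v - l ^ 2 * al) (/ l ^ 2) (v - / l ^ 2 * v);
        [|lra|auto| |auto|].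
      * apply affine_up_to_step with (u + (l + 1) * al) 1 ((l ^ 2 - 1) * al);
          [|lra|auto| |auto|].
        -- apply affine_up_to_step with u l (u - l * u); [|lra|auto| |auto|].
           ++ apply affine_up_to_step with 0 1 0; auto using affine_up_to_0.
              ** rewrite bump_left by lra. auto.
              ** intros t ht. rewrite bump_left; lra.
           ++ rewrite bump_left by lra. auto.
           ++ intros t ht. rewrite bump_slope_l; lra.
        -- rewrite bump_slope_l by lra.
           replace (u + l * (u + (l + 1) * al - u)) with (u + l * ((l + 1) * al)) by ring.
           auto.
        -- intros t ht. rewrite bump_translation; lra.
      * rewrite bump_translation by lra.
        replace (v - l ^ 2 * al + (l ^ 2 - 1) * al) with (v - al) by ring. auto.
      * intros t ht. rewrite bump_slope_r; lra.
    + rewrite bump_right by lra. auto.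
    + intros t ht. rewrite bump_right; lra.
Qed.

End Bump.

(** * The centralizer of a bump *)

Definition pw (f : R -> R) (n : nat) : R -> R := fun x => Nat.iter n f x.

Lemma pw_add f m n x : pw f (m + n) x = pw f m (pw f n x).
Proof. unfold pw. induction m; simpl; congruence. Qed.

Lemma pw_S_r f n x : pw f (S n) x = pw f n (f x).
Proof. rewrite <- Nat.add_1_r, pw_add. reflexivity. Qed.

Lemma pw_incr f n :
  (forall x y, x < y -> f x < f y) -> forall x y, x < y -> pw f n x < pw f n y.
Proof. intros h. unfold pw. induction n; simpl; auto. Qed.

Lemma pw_cancel f f' n : (forall x, f (f' x) = x) -> forall x, pw f n (pw f' n x) = x.
Proof.
  intros h. induction n; intros x; [reflexivity|].
  rewrite pw_S_r. change (pw f' (S n) x) with (f' (pw f' n x)). rewrite h. apply IHn.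
Qed.

Lemma pw_commute f g n : (forall x, g (f x) = f (g x)) -> forall x, g (pw f n x) = pw f n (g x).
Proof. intros h x. unfold pw. induction n; simpl; congruence. Qed.

(** Either division or multiplication by some [l ^ n] brings [m] into [[1, l)]; this normalizes the
    slope at 0. *)
Lemma power_between l m :
  1 < l -> 0 < m ->
  exists n, l ^ n <= m < l * l ^ n \/ 1 <= m * l ^ n < l.
Proof.
  intros hl hm.
  assert (hp : forall n, 0 < l ^ n) by (intros; apply pow_lt; lra).
  assert (unbounded : forall B, exists N, B < l ^ N).
  { intros B. destruct (Pow_x_infinity l) with (b := B + 1) as [N HN].
    - rewrite Rabs_right; lra.
    - exists N. specialize (HN N (le_n _)).
      rewrite Rabs_right in HN by (apply Rle_ge; left; auto). lra. }
  destruct (Rle_dec 1 m) as [h1 | h1].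
  - destruct (unbounded m) as [N HN]. induction N as [|N IH]; simpl in *; [lra|].
    destruct (Rle_dec (l ^ N) m); [exists N; left; lra | apply IH; lra].
  - destruct (unbounded (/ m)) as [N HN].
    assert (HN' : 1 <= m * l ^ N).
    { apply (Rmult_lt_compat_l m) in HN; auto. rewrite Rinv_r in HN by lra. lra. }
    clear HN. induction N as [|N IH]; simpl in *; [lra|].
    destruct (Rle_dec 1 (m * l ^ N)); [auto|]. exists (S N). right. simpl.
    assert (l * (m * l ^ N) < l * 1) by (apply Rmult_lt_compat_l; lra). lra.
Qed.

(** One-sided slope, by exact affinity to the right of [x]; elements of [V] have one at every point
    of [[0, r)], breakpoints and discontinuities included. *)
Definition rslope (g : R -> R) (x m : R) : Prop :=
  exists e, 0 < e /\ forall y, x <= y < x + e -> g y = g x + m * (y - x).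

Lemma rslope_unique g x m n : rslope g x m -> rslope g x n -> m = n.
Proof.
  intros (e & he & H) (e' & he' & H').
  set (d := Rmin e e' / 2).
  assert (0 < d /\ d < e /\ d < e').
  { unfold d. assert (h1 := Rmin_l e e'). assert (h2 := Rmin_r e e').
    assert (0 < Rmin e e') by (apply Rmin_glb_lt; auto). lra. }
  specialize (H (x + d)); specialize (H' (x + d)).
  rewrite H in H' by lra. clear H. specialize (H' ltac:(lra)). nra.
Qed.

(** The chain rule; [m > 0] keeps [f y] to the right of [f x]. *)
Lemma rslope_comp f g x m n :
  0 < m -> rslope f x m -> rslope g (f x) n -> rslope (fun y => g (f y)) x (n * m).
Proof.
  intros hm (e & he & H) (e' & he' & H').
  exists (Rmin e (e' / m)). split.
  - apply Rmin_glb_lt; auto. apply Rdiv_lt_0_compat; auto.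
  - intros y hy. assert (h1 := Rmin_l e (e' / m)). assert (h2 := Rmin_r e (e' / m)).
    assert (h3 : m * (y - x) < e').
    { replace e' with (m * (e' / m)) by (field; lra). apply Rmult_lt_compat_l; lra. }
    rewrite (H y) by lra. rewrite H' by nra. ring.
Qed.

Lemma rslope_of_affine g p q m b :
  (forall y, p <= y < q -> g y = m * y + b) -> forall x, p <= x < q -> rslope g x m.
Proof.
  intros h x hx. exists (q - x). split; [lra|]. intros y hy.
  rewrite !h by lra. ring.
Qed.

Lemma subdivision_locate k (a : nat -> R) x :
  a 0%nat <= x < a k -> exists i, (i < k)%nat /\ a i <= x < a (S i).
Proof.
  induction k; intros hx; [lra|].
  destruct (Rlt_dec x (a k)) as [h|h].
  - destruct IHk as (i & hi & H); [lra|]. exists i. split; [lia|auto].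
  - exists k. split; [lia|lra].
Qed.

Lemma isV_rslope r g x :
  isV r allPos allR g -> in_I r x -> exists m, 0 < m /\ rslope g x m.
Proof.
  intros (_ & _ & _ & _ & k & a & h0 & hk & _ & hp) [hx hx'].
  destruct (subdivision_locate k a x) as (i & hi & Hi); [lra|].
  destruct (hp i hi) as (_ & _ & m & b & hm & H).
  exists m. split; auto. eapply rslope_of_affine; eauto.
Qed.

Lemma isV_rslope_end r g :
  0 < r -> isV r allPos allR g ->
  exists m e, 0 < e /\ forall x, r - e <= x < r -> rslope g x m.
Proof.
  intros hr (_ & _ & _ & _ & k & a & h0 & hk & hs & hp).
  destruct k as [|k]; [lra|].
  destruct (hp k) as (_ & _ & m & b & hm & H); [lia|].
  exists m, (r - a k). split; [specialize (hs k); rewrite hk in hs; specialize (hs ltac:(lia)); lra|].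
  intros x hx. rewrite <- hk in hx at 1. eapply rslope_of_affine; eauto. lra.
Qed.

(** * Dynamics of the bump [t] on [[0, r)] *)

Section Centralizer.

Variables l r al : R.
Hypothesis hl : 1 < l.
Hypothesis hal : 0 < al.
Hypothesis hroom : 3 * l ^ 2 * al <= r.

(** [t] has slope [l] on [[0, a]], is the translation by [dl] on [[a, b]], and has slope [/ l ^ 2]
    on [[b, r]]. *)
Local Notation t := (bump l 0 r al).
Local Notation a := ((l + 1) * al).
Local Notation dl := ((l ^ 2 - 1) * al).
Local Notation b := (r - l ^ 2 * al).

Lemma room_bump : (l ^ 2 + l + 1) * al <= r - 0.
Proof.
  assert (h : l ^ 2 + l + 1 <= 3 * l ^ 2) by nra.
  apply (Rmult_le_compat_r al) in h; lra.
Qed.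

(** The translation zone [[a, b]] is at least one step [dl] long, since [a + dl + l ^ 2 * al = (2 *
    l ^ 2 + l) * al] is at most [3 * l ^ 2 * al]. *)
Lemma breaks_order : 0 < a /\ 0 < dl /\ a + dl <= b /\ b < r.
Proof.
  assert (0 < dl) by (apply Rmult_lt_0_compat; nra).
  assert (h : 2 * l ^ 2 + l <= 3 * l ^ 2) by nra.
  apply (Rmult_le_compat_r al) in h; [|lra].
  assert (0 < l ^ 2 * al) by (apply Rmult_lt_0_compat; nra).
  repeat split; nra.
Qed.

Lemma t_incr x y : x < y -> t x < t y.
Proof.
  destruct (bump_inverse_pair l 0 r al hl) as (h' & H & _). apply H.
Qed.

Lemma t_left x : 0 <= x <= a -> t x = l * x.
Proof.
  intros. rewrite bump_slope_l by (exact room_bump || lra). ring.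
Qed.

Lemma t_mid x : a <= x <= b -> t x = x + dl.
Proof. intros. apply bump_translation; lra. Qed.

Lemma t_end x : b <= x <= r -> t x = r + / l ^ 2 * (x - r).
Proof. intros. apply bump_slope_r; exact room_bump || lra. Qed.

Lemma t_0 : t 0 = 0.
Proof. rewrite t_left; [ring|]. assert (h := breaks_order). lra. Qed.

Lemma t_r : t r = r.
Proof. rewrite t_end; [ring|]. assert (h := breaks_order). lra. Qed.

(** The displacement is [(l - 1) * z], [dl] or [(1 - / l ^ 2) * (r - z)] according to the piece, and
    each is bounded below on [[u, v]]. This forces orbits past every point below [r]. *)
Lemma t_displacement u v :
  0 < u -> v < r -> exists m, 0 < m /\ forall z, u <= z <= v -> z + m <= t z.
Proof.
  intros hu hv. assert (H := breaks_order). destruct (inv_sq l hl) as [hi hi2].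
  assert (p1 : 0 < (l - 1) * u) by nra.
  assert (p2 : 0 < (1 - / l ^ 2) * (r - v)) by (apply Rmult_lt_0_compat; lra).
  exists (Rmin ((l - 1) * u) (Rmin dl ((1 - / l ^ 2) * (r - v)))).
  split; [repeat apply Rmin_glb_lt; lra|].
  intros z hz.
  assert (h1 := Rmin_l ((l - 1) * u) (Rmin dl ((1 - / l ^ 2) * (r - v)))).
  assert (h2 := Rmin_r ((l - 1) * u) (Rmin dl ((1 - / l ^ 2) * (r - v)))).
  assert (h3 := Rmin_l dl ((1 - / l ^ 2) * (r - v))).
  assert (h4 := Rmin_r dl ((1 - / l ^ 2) * (r - v))).
  destruct (Rle_dec z a); [rewrite t_left by lra; nra|].
  destruct (Rle_dec z b); [rewrite t_mid by lra; nra|].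
  rewrite t_end by lra. nra.
Qed.

Lemma t_gt x : 0 < x < r -> x < t x.
Proof.
  intros hx. destruct (t_displacement x x) as (m & hm & H); [lra|lra|].
  specialize (H x). lra.
Qed.

Lemma t_in x : 0 < x < r -> 0 < t x < r.
Proof.
  intros hx. assert (h1 := t_incr 0 x). assert (h2 := t_incr x r).
  rewrite t_0 in h1. rewrite t_r in h2. lra.
Qed.

Lemma pw_t_in n x : 0 < x < r -> 0 < pw t n x < r.
Proof. intros hx. induction n; [exact hx|]. apply t_in. exact IHn. Qed.

Lemma t_reach u v : 0 < u < r -> v < r -> exists n, v < pw t n u.
Proof.
  intros hu hv. destruct (t_displacement u v) as (m & hm & H); [lra|lra|].
  assert (K : forall n, v < pw t n u \/ u + INR n * m <= pw t n u).
  { induction n as [|n IH]; [right; simpl; lra|].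
    assert (hn := pw_t_in n u hu). assert (h' := t_gt (pw t n u) hn).
    assert (0 <= INR n) by apply pos_INR.
    rewrite S_INR. change (pw t (S n) u) with (t (pw t n u)).
    destruct IH as [IH | IH]; [left; lra|].
    destruct (Rlt_dec v (pw t n u)) as [h|h]; [left; lra|].
    right. specialize (H (pw t n u)). nra. }
  destruct (INR_unbounded ((v - u) / m)) as [n hn].
  exists n. destruct (K n) as [h|h]; [exact h|].
  apply (Rmult_lt_compat_r m) in hn; auto.
  replace ((v - u) / m * m) with (v - u) in hn by (field; lra). lra.
Qed.

(** Backward orbits of [t] in [(0, r)] come arbitrarily close to 0, so a property that holds near 0
    and is carried along by [t] holds throughout. *)
Lemma orbit_ind (P : R -> Prop) e :
  0 < e -> (forall x, 0 < x < e -> x < r -> P x) ->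
  (forall x, 0 < x < r -> P x -> P (t x)) -> forall x, 0 < x < r -> P x.
Proof.
  intros he hbase hstep x hx.
  destruct (bump_inverse_pair l 0 r al hl) as (t' & _ & t'_incr & h1 & h2).
  assert (hr : 0 < Rmin e r / 2 < r /\ Rmin e r / 2 < e).
  { assert (h3 := Rmin_l e r). assert (h4 := Rmin_r e r).
    assert (0 < Rmin e r) by (apply Rmin_glb_lt; lra). lra. }
  destruct (t_reach (Rmin e r / 2) x) as [n hn]; [lra|lra|].
  assert (hlt : pw t' n x < e).
  { apply Rlt_trans with (Rmin e r / 2); [|lra].
    rewrite <- (pw_cancel t' t n h1 (Rmin e r / 2)). apply pw_incr; auto. }
  clear hn. revert x hx hlt. induction n as [|n IH]; intros x hx hlt.
  - apply hbase; [exact (conj (proj1 hx) hlt)|lra].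
  - rewrite pw_S_r in hlt. rewrite <- (h2 x).
    assert (0 < t' x < r).
    { assert (k1 := t'_incr 0 x). assert (k2 := t'_incr x r).
      replace (t' 0) with 0 in k1 by (rewrite <- t_0 at 2; symmetry; apply h1).
      replace (t' r) with r in k2 by (rewrite <- t_r at 2; symmetry; apply h1). lra. }
    auto.
Qed.

Lemma t_rslope x :
  0 <= x < r -> rslope t x (if Rlt_dec x a then l else if Rlt_dec x b then 1 else / l ^ 2).
Proof.
  intros hx. assert (H := breaks_order).
  destruct (Rlt_dec x a).
  - apply rslope_of_affine with 0 a 0; [|lra]. intros y hy. rewrite t_left; lra.
  - destruct (Rlt_dec x b).
    + apply rslope_of_affine with a b dl; [|lra]. intros y hy. rewrite t_mid; lra.
    + apply rslope_of_affine with b r (r - / l ^ 2 * r); [|lra].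
      intros y hy. rewrite t_end; lra.
Qed.

(** * Maps in [V] commuting with [t] *)

Section Commuting.

Variable g : R -> R.
Hypothesis gV : isV r allPos allR g.
Hypothesis gt : forall x, g (t x) = t (g x).

(** [g 0] is a fixed point of [t] in [[0, r)], and 0 is the only one. *)
Lemma commuting_fix_0 : g 0 = 0.
Proof.
  assert (H := breaks_order).
  destruct gV as (_ & hI & _). destruct (hI 0) as [h1 h2]; [unfold in_I; lra|].
  assert (h := gt 0). rewrite t_0 in h.
  destruct (Req_dec (g 0) 0) as [e|e]; [exact e|].
  assert (h3 := t_gt (g 0)). lra.
Qed.

Lemma commuting_in x : 0 < x < r -> 0 < g x < r.
Proof.
  intros hx. destruct gV as (_ & hI & _ & hinj & _).
  destruct (hI x) as [h1 h2]; [unfold in_I; lra|].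
  split; [|lra]. destruct h1 as [h1|h1]; [exact h1|].
  assert (e : x = 0); [|lra]. apply hinj; unfold in_I; try lra.
  rewrite commuting_fix_0. auto.
Qed.

Lemma commuting_rslope x m n p q :
  rslope g x m -> rslope g (t x) n -> rslope t x p -> rslope t (g x) q ->
  0 < m -> 0 < p -> n * p = q * m.
Proof.
  intros h1 h2 h3 h4 hm hp.
  apply (rslope_unique (fun y => g (t y)) x).
  - exact (rslope_comp t g x p n hp h3 h2).
  - rewrite (functional_extensionality _ _ gt).
    exact (rslope_comp g t x m q hm h1 h4).
Qed.

(** [g] is the identity near 0, and this spreads along the orbits of [t]. *)
Lemma commuting_id : rslope g 0 1 -> forall x, g x = x.
Proof.
  intros (e & he & H). rewrite commuting_fix_0 in H.
  assert (K : forall x, 0 < x < r -> g x = x).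
  { apply orbit_ind with e; auto.
    - intros x hx _. rewrite H; lra.
    - intros x hx hgx. rewrite gt, hgx. reflexivity. }
  intros x. destruct (Rlt_dec 0 x); [destruct (Rlt_dec x r)|].
  - apply K; lra.
  - apply (proj1 gV). intros []. lra.
  - destruct (Req_dec x 0) as [->|]; [apply commuting_fix_0|].
    apply (proj1 gV). intros []. lra.
Qed.

(* If the slope at 0 were strictly between [1] and [l], the slopes of [g] on
   one fundamental domain of [t] near [r] would take two values, whereas the
   slope is [t]-invariant there and constant near [r]. *)
Lemma commuting_slope_gap mu : 1 < mu < l -> ~ rslope g 0 mu.
Proof.
  intros hmu (e & he & H). rewrite commuting_fix_0 in H.
  assert (Hab := breaks_order). destruct (inv_sq l hl) as [hi hi2].
  assert (between : forall x, 0 < x < r -> x < g x < t x).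
  { apply orbit_ind with (Rmin e a).
    - apply Rmin_glb_lt; lra.
    - intros x hx _. assert (h1 := Rmin_l e a). assert (h2 := Rmin_r e a).
      rewrite H by lra. rewrite t_left by lra. nra.
    - intros x hx [h1 h2]. rewrite gt. split; apply t_incr; auto. }
  (* While [t (g x) <= b], passing from [x] to [t x] changes the slope of [g] only if
     [x < a <= g x], where [t] has slope [l] at [x] and 1 at [g x]. This divides the slope by [l],
     and happens at most once on an orbit because then [a < t x]. *)
  assert (slopes : forall x, 0 < x < r -> g x <= b ->
            rslope g x mu \/ (a <= x /\ rslope g x (mu / l))).
  { apply (orbit_ind (fun x => g x <= b ->
            rslope g x mu \/ (a <= x /\ rslope g x (mu / l))) e); auto.
    - intros x hx _ _. left. apply rslope_of_affine with 0 e 0; [|lra].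
      intros y hy. rewrite H; lra.
    - intros x hx IH hb. rewrite gt in hb.
      assert (hgx := commuting_in x hx). assert (h1 := t_gt (g x) hgx).
      assert (h2 := between x hx). assert (htx := t_in x hx).
      assert (h3 := t_gt x hx).
      destruct (isV_rslope r g (t x) gV) as (n & hn & sn); [unfold in_I; lra|].
      assert (s1 := t_rslope x ltac:(lra)).
      assert (s2 := t_rslope (g x) ltac:(lra)).
      destruct (Rlt_dec x a) as [xa|xa].
      + destruct IH as [IH | [? _]]; [lra| |lra].
        assert (E := commuting_rslope x mu n _ _ IH sn s1 s2 ltac:(lra) ltac:(lra)).
        destruct (Rlt_dec (g x) a) as [gxa|gxa].
        * left. replace mu with n; auto. apply Rmult_eq_reg_l with l; lra.
        * right. destruct (Rlt_dec (g x) b); [|lra].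
          assert (h4 : a <= t x) by lra. split; [lra|].
          replace (mu / l) with n; auto. apply Rmult_eq_reg_r with l; [|lra].
          rewrite E. field. lra.
      + destruct (Rlt_dec x b); [|lra].
        destruct (Rlt_dec (g x) a); [lra|]. destruct (Rlt_dec (g x) b); [|lra].
        destruct IH as [IH | [_ IH]]; [lra| |].
        * left. assert (E := commuting_rslope x mu n _ _ IH sn s1 s2 ltac:(lra) ltac:(lra)).
          replace mu with n; auto. lra.
        * right. split; [lra|].
          assert (0 < mu / l) by (apply Rdiv_lt_0_compat; lra).
          assert (E := commuting_rslope x (mu / l) n _ _ IH sn s1 s2 ltac:(lra) ltac:(lra)).
          replace (mu / l) with n; auto. lra. }
  destruct (isV_rslope_end r g ltac:(lra) gV) as (m & d & hd & hend).
  (* For [y] in [[b, r)], [t] has slope [/ l ^ 2] at both [y] and [g y], and these factors cancel in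
     the chain rule. *)
  assert (invariant : forall n y k, b <= y < r -> rslope g y k -> rslope g (pw t n y) k).
  { induction n as [|n IH]; intros y k hy hk; [exact hk|].
    rewrite pw_S_r. assert (hty := t_in y ltac:(lra)).
    assert (h1 := t_gt y ltac:(lra)). assert (h2 := between y ltac:(lra)).
    apply IH; [lra|].
    destruct (isV_rslope r g y gV) as (k' & hk' & sk'); [unfold in_I; lra|].
    rewrite (rslope_unique _ _ _ _ hk sk').
    destruct (isV_rslope r g (t y) gV) as (n' & hn' & sn'); [unfold in_I; lra|].
    assert (hgy := commuting_in y ltac:(lra)).
    assert (s1 := t_rslope y ltac:(lra)).
    assert (s2 := t_rslope (g y) ltac:(lra)).
    destruct (Rlt_dec y a); [lra|]. destruct (Rlt_dec y b); [lra|].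
    destruct (Rlt_dec (g y) a); [lra|]. destruct (Rlt_dec (g y) b); [lra|].
    assert (E := commuting_rslope y k' n' _ _ sk' sn' s1 s2 hk' ltac:(lra)).
    replace k' with n'; auto. apply Rmult_eq_reg_l with (/ l ^ 2); lra. }
  assert (eventually : forall y k, b <= y < r -> rslope g y k -> k = m).
  { intros y k hy hk.
    destruct (t_reach y (r - d)) as [n hn]; [lra|lra|].
    apply (rslope_unique g (pw t n y)); [auto|]. apply hend.
    assert (h := pw_t_in n y ltac:(lra)). lra. }
  assert (mul : 0 < mu / l /\ mu / l * l = mu).
  { split; [apply Rdiv_lt_0_compat; lra | field; lra]. }
  (* For [x = b - dl], both [x] and [g x] lie in [[a, b)], where [t] is a translation; so the slope
     [m] at [t x = b] equals the slope at [x], which is [mu] or [mu / l]. *)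
  assert (m_large : mu / l <= m).
  { set (x := b - dl).
    assert (hx : 0 < x < r) by (unfold x; lra).
    assert (tx : t x = b) by (rewrite t_mid; unfold x; lra).
    assert (hgx := between x hx). rewrite tx in hgx.
    destruct (isV_rslope r g b gV) as (n & hn & sn); [unfold in_I; lra|].
    rewrite <- (eventually b n ltac:(lra) sn). rewrite <- tx in sn.
    assert (s1 := t_rslope x ltac:(lra)).
    assert (s2 := t_rslope (g x) ltac:(lra)).
    assert (xa : a <= x) by (unfold x; lra).
    destruct (Rlt_dec x a); [lra|]. destruct (Rlt_dec x b); [|lra].
    destruct (Rlt_dec (g x) a); [lra|]. destruct (Rlt_dec (g x) b); [|lra].
    destruct (slopes x hx) as [s|[_ s]]; [lra| |].
    - assert (E := commuting_rslope x mu n _ _ s sn s1 s2 ltac:(lra) ltac:(lra)). nra.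
    - assert (E := commuting_rslope x _ n _ _ s sn s1 s2 (proj1 mul) ltac:(lra)). lra. }
  (* If [g x = b], then [t] has slope 1 at [x] and [/ l ^ 2] at [g x], so [m] is [/ l ^ 2] times a
     slope that is at most [mu]. Together with the previous bound this gives [mu / l <= mu / l ^ 2],
     impossible for [l > 1]. *)
  assert (m_small : m <= / l ^ 2 * mu).
  { destruct gV as (_ & _ & hsurj & _).
    destruct (hsurj b) as (x & [hx1 hx2] & gx); [unfold in_I; lra|].
    destruct hx1 as [hx1|<-]; [|rewrite commuting_fix_0 in gx; lra].
    assert (hx : 0 < x < r) by lra.
    assert (hgx := between x hx). rewrite gx in hgx.
    assert (xa : a < x).
    { destruct (Rlt_dec a x); [auto|]. assert (t x <= t a).
      { apply incr_le; [exact t_incr|lra]. }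
      rewrite (t_mid a) in H0; lra. }
    assert (htx := t_in x hx).
    destruct (isV_rslope r g (t x) gV) as (n & hn & sn); [unfold in_I; lra|].
    rewrite <- (eventually (t x) n ltac:(lra) sn).
    assert (s1 := t_rslope x ltac:(lra)).
    assert (s2 : rslope t (g x) (/ l ^ 2)).
    { rewrite gx. assert (s := t_rslope b ltac:(lra)).
      destruct (Rlt_dec b a); [lra|]. destruct (Rlt_dec b b); [lra|]. exact s. }
    destruct (Rlt_dec x a); [lra|]. destruct (Rlt_dec x b); [|lra].
    destruct (slopes x hx) as [s|[_ s]]; [lra| |].
    - assert (E := commuting_rslope x mu n _ _ s sn s1 s2 ltac:(lra) ltac:(lra)). lra.
    - assert (E := commuting_rslope x _ n _ _ s sn s1 s2 (proj1 mul) ltac:(lra)).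
      rewrite <- (Rmult_1_r n), E. apply Rmult_le_compat_l; [lra|]. nra. }
  nra.
Qed.

End Commuting.

Lemma centralizer_cyclic (G : (R -> R) -> Prop) t' g :
  is_subgroup_of_V r G -> G t -> G t' ->
  (forall x, t' (t x) = x) -> (forall x, t (t' x) = x) ->
  G g -> (forall x, g (t x) = t (g x)) ->
  exists n, (forall x, g x = pw t n x) \/ (forall x, g x = pw t' n x).
Proof.
  intros (GV & G1 & Gmul & _) Gt Gt' h1 h2 Gg gt.
  assert (Hab := breaks_order).
  assert (Gpw : forall f n, G f -> G (pw f n)).
  { intros f n Gf. induction n; [exact G1|]. exact (Gmul _ _ IHn Gf). }
  assert (gt' : forall x, g (t' x) = t' (g x)).
  { intros x. rewrite <- (h1 (g (t' x))), <- gt, h2. reflexivity. }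
  assert (tt' : forall x, t (t' x) = t' (t x)) by congruence.
  assert (key : forall h, G h -> (forall x, h (t x) = t (h x)) ->
            forall m, rslope h 0 m -> 1 <= m < l -> forall x, h x = x).
  { intros h Gh ht m hm [[hm1|<-] hm2].
    - exfalso. exact (commuting_slope_gap h (GV h Gh) ht m (conj hm1 hm2) hm).
    - exact (commuting_id h (GV h Gh) ht hm). }
  destruct (isV_rslope r g 0 (GV g Gg)) as (mu & hmu & smu); [unfold in_I; lra|].
  assert (g0 : g 0 = 0) by exact (commuting_fix_0 g (GV g Gg) gt).
  assert (st : rslope t 0 l).
  { assert (s := t_rslope 0 ltac:(lra)). destruct (Rlt_dec 0 a); [exact s|lra]. }
  assert (st' : rslope t' 0 (/ l)).
  { assert (t'0 : t' 0 = 0) by (rewrite <- t_0 at 1; apply h1).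
    (* [l * a] is [t a], the end of the image of the first piece of [t]. *)
    exists (l * a). split; [nra|]. intros y hy.
    rewrite t'0. rewrite <- (h1 (0 + / l * (y - 0))). f_equal.
    assert (0 < / l) by (apply Rinv_0_lt_compat; lra).
    assert (/ l * l = 1) by (field; lra).
    rewrite t_left; [field; lra|]. nra. }
  assert (spw : forall f k n, 0 < k -> f 0 = 0 -> rslope f 0 k ->
            pw f n 0 = 0 /\ rslope (pw f n) 0 (k ^ n)).
  { intros f k n hk f0 sf. induction n as [|n [IH1 IH2]].
    - split; [reflexivity|]. exists 1. split; [lra|]. intros. unfold pw; simpl. lra.
    - split; [change (f (pw f n 0) = 0); congruence|].
      apply (rslope_comp (pw f n) f); [apply pow_lt; auto|exact IH2|].
      rewrite IH1. exact sf. }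
  assert (hl' : 0 < / l) by (apply Rinv_0_lt_compat; lra).
  destruct (power_between l mu hl hmu) as [n [hn|hn]]; exists n.
  - left.
    assert (K : forall x, pw t' n (g x) = x).
    { apply key with (/ l ^ n * mu).
      - exact (Gmul _ _ Gg (Gpw _ n Gt')).
      - intros x. rewrite gt. symmetry. apply pw_commute. exact tt'.
      - rewrite <- pow_inv. apply (rslope_comp g (pw t' n)); auto.
        rewrite g0. apply spw; auto. rewrite <- t_0 at 1; apply h1.
      - assert (0 < l ^ n) by (apply pow_lt; lra).
        assert (0 < / l ^ n) by (apply Rinv_0_lt_compat; auto).
        assert (/ l ^ n * l ^ n = 1) by (field; lra). nra. }
    intros x. rewrite <- (K x) at 2. symmetry. apply pw_cancel. auto.
  - right.
    assert (K : forall x, pw t n (g x) = x).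
    { apply key with (l ^ n * mu).
      - exact (Gmul _ _ Gg (Gpw _ n Gt)).
      - intros x. rewrite gt. symmetry. apply pw_commute. reflexivity.
      - apply (rslope_comp g (pw t n)); auto.
        rewrite g0. apply spw; auto using t_0. lra.
      - lra. }
    intros x. rewrite <- (K x) at 2. symmetry. apply pw_cancel. auto.
Qed.

End Centralizer.

(** * Coding the natural numbers in the group *)

Section Coding.

Variables (r : R) (G : (R -> R) -> Prop) (t ti s c : R -> R) (p q : R).

Local Notation "x ** y" := (grp_op SMul x y) (at level 40, left associativity).

Hypothesis hG : is_subgroup_of_V r G.
Hypotheses (Gt : G t) (Gti : G ti) (Gs : G s) (Gc : G c).
Hypothesis ti_t : forall x, ti (t x) = x.
Hypothesis t_ti : forall x, t (ti x) = x.
Hypothesis t_incr : forall x y, x < y -> t x < t y.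
Hypothesis s_incr : forall x y, x < y -> s x < s y.
Hypothesis c_incr : forall x y, x < y -> c x < c y.
Hypothesis hpq : p < q.
Hypothesis hqt : q <= t p.
Hypothesis c_left : forall x, x <= p -> c x = x.
Hypothesis c_right : forall x, q <= x -> c x = x.
Hypothesis c_moves : exists x, p < x < q /\ c x <> x.
Hypothesis s_left : forall x, x <= q -> s x = x.
Hypothesis s_right : forall x, t p <= x -> s x = t x.
Hypothesis t_centralizer : forall g, G g -> (forall x, g (t x) = t (g x)) ->
  exists n, (forall x, g x = pw t n x) \/ (forall x, g x = pw ti n x).

Local Notation T := (pw ti).
Local Notation J x := (p < x < q).

Lemma G_mul x y : G x -> G y -> G (fun z => y (x z)).
Proof. intros. apply hG; auto. Qed.

Lemma G_pw f n : G f -> G (pw f n).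
Proof.
  intros Gf. induction n; [apply hG|]. exact (G_mul _ _ IHn Gf).
Qed.

Lemma G_inj x : G x -> forall y z, x y = x z -> y = z.
Proof.
  intros Gx y z e. destruct hG as (_ & _ & _ & Ginv).
  destruct (Ginv x Gx) as (x' & _ & E & _).
  assert (h : forall w, x' (x w) = w).
  { intros w. exact (f_equal (fun h => h w) E). }
  rewrite <- (h y), <- (h z), e. reflexivity.
Qed.

Lemma G_surj x : G x -> forall z, exists y, x y = z.
Proof.
  intros Gx z. destruct hG as (_ & _ & _ & Ginv).
  destruct (Ginv x Gx) as (x' & _ & _ & E).
  exists (x' z). exact (f_equal (fun h => h z) E).
Qed.

Lemma ti_incr x y : x < y -> ti x < ti y.
Proof.
  intros h. destruct (Rlt_dec (ti x) (ti y)) as [h'|h']; [exact h'|].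
  assert (h2 : t (ti y) <= t (ti x)) by (apply incr_le; auto; lra).
  rewrite !t_ti in h2. lra.
Qed.

Lemma t_ge x n : p <= x -> t p <= pw t (S n) x.
Proof.
  intros hx. assert (h := incr_le _ t_incr).
  induction n; [apply h; auto|]. change (t p <= t (pw t (S n) x)). apply h. lra.
Qed.

Lemma T_le x n : x <= q -> T n x <= q.
Proof.
  intros hx. induction n; [auto|]. change (ti (T n x) <= q).
  assert (h : ti q < q).
  { rewrite <- (ti_t q) at 2. apply ti_incr. assert (h := t_incr p q hpq). lra. }
  assert (ti (T n x) <= ti q) by (apply incr_le; [exact ti_incr|auto]). lra.
Qed.

Lemma pwt_T n x : pw t n (T n x) = x.
Proof. apply pw_cancel. exact t_ti. Qed.

Lemma T_pwt n x : T n (pw t n x) = x.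
Proof. apply pw_cancel. exact ti_t. Qed.

(** Cancelling [T i] would give [pw t (S n) x = y], but the left side is at least [t p], hence at
    least [q]. *)
Lemma T_J_disjoint_lt i n x y : J x -> J y -> T i x <> T (i + S n) y.
Proof.
  intros hx hy e. rewrite pw_add in e.
  apply G_inj in e; [|apply G_pw; auto].
  assert (e' : pw t (S n) x = y) by (rewrite e; apply pwt_T).
  assert (h := t_ge x n). lra.
Qed.

Lemma T_J_disjoint i j x y : J x -> J y -> T i x = T j y -> i = j.
Proof.
  intros hx hy e. destruct (lt_eq_lt_dec i j) as [[h|h]|h]; [|exact h|]; exfalso.
  - apply (T_J_disjoint_lt i (j - i - 1) x y hx hy).
    replace (i + S (j - i - 1))%nat with j by lia. exact e.
  - apply (T_J_disjoint_lt j (i - j - 1) y x hy hx).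
    replace (j + S (i - j - 1))%nat with i by lia. auto.
Qed.

Lemma T_inj i j : T i = T j -> i = j.
Proof.
  intros e. apply (T_J_disjoint i j ((p + q) / 2) ((p + q) / 2)); [lra|lra|congruence].
Qed.

Lemma T_mul i j : T i ** T j = T (i + j).
Proof.
  apply functional_extensionality. intros x. rewrite Nat.add_comm, pw_add. reflexivity.
Qed.

Lemma T_S j : T j ** ti = T (S j).
Proof. reflexivity. Qed.

Lemma c_J x : J x -> J (c x).
Proof.
  intros hx. assert (h1 := c_incr p x). assert (h2 := c_incr x q).
  rewrite (c_left p) in h1 by lra. rewrite (c_right q) in h2 by lra. lra.
Qed.

Lemma c_fix x : ~ J x -> c x = x.
Proof.
  intros h. destruct (Rle_dec x p); [auto|]. apply c_right.
  destruct (Rle_dec q x); [auto|]. exfalso. apply h. lra.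
Qed.

(** The conjugate of [c] by [T n], a copy of [c] living on [T n J]. *)
Definition cT n : R -> R := fun x => T n (c (pw t n x)).

Lemma G_cT n : G (cT n).
Proof.
  apply (G_mul (fun x => c (pw t n x)) (T n)); [apply (G_mul (pw t n) c)|];
    auto using G_pw.
Qed.

Lemma cT_T n : T n ** cT n = c ** T n.
Proof.
  apply functional_extensionality. intros x. unfold grp_op, cT.
  rewrite pwt_T. reflexivity.
Qed.

Lemma T_definable x :
  G x -> ((x ** t = t ** x /\ exists y, G y /\ x ** y = c ** x /\ y ** s = s ** y)
          <-> exists n, x = T n).
Proof.
  intros Gx. split.
  - intros (xt & y & Gy & xy & ys).
    assert (xt' : forall z, x (t z) = t (x z)).
    { intros z. exact (f_equal (fun h => h z) (eq_sym xt)). }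
    destruct (t_centralizer x Gx xt') as [n [hn|hn]];
      [|exists n; apply functional_extensionality; auto].
    destruct n as [|n]; [exists 0%nat; apply functional_extensionality; exact hn|].
    (* Here [x] is a positive power of [t], so its conjugate [y] of [c] lives beyond [t p], where
       [s] is [t]. Comparing [y ** s] and [s ** y] at [pw t (S n) z] gives [c z = z], since [c]
       fixes [t z]. *)
    exfalso. destruct c_moves as (z & hz & hcz). apply hcz.
    assert (xy' : forall w, y (pw t (S n) w) = pw t (S n) (c w)).
    { intros w. rewrite <- !hn. exact (f_equal (fun h => h w) xy). }
    assert (e := f_equal (fun h => h (pw t (S n) z)) ys).
    unfold grp_op in e. rewrite xy' in e.
    assert (hcJ := c_J z hz).
    rewrite !s_right in e by (apply t_ge; lra).
    change (t (pw t (S n) z)) with (pw t (S (S n)) z) in e.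
    rewrite (pw_S_r t (S n) z), xy', (c_right (t z)) in e
      by (apply Rle_trans with (t p); auto; apply incr_le; auto; lra).
    rewrite <- pw_S_r in e. apply (G_inj (pw t (S (S n)))); auto using G_pw.
  - intros [n ->]. split.
    { apply functional_extensionality. intros z. unfold grp_op.
      apply pw_commute. congruence. }
    exists (cT n). split; [apply G_cT|]. split; [apply cT_T|].
    (* [cT n] is the identity from [q] on and [s] up to [q]. As both increase, each preserves the
       two sides of [q], so they commute. *)
    assert (fixed : forall z, q <= z -> cT n z = z).
    { intros z hz. unfold cT. rewrite c_right; [apply T_pwt|].
      destruct n as [|n]; [exact hz|].
      apply Rle_trans with (t p); auto. apply t_ge. lra. }
    assert (incr : forall z w, z < w -> cT n z < cT n w).
    { intros z w h. unfold cT. apply pw_incr; [exact ti_incr|].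
      apply c_incr, pw_incr; auto. }
    apply functional_extensionality. intros z. unfold grp_op.
    destruct (Rle_dec z q) as [hz|hz].
    + rewrite !s_left; auto. rewrite <- (fixed q) by lra. apply incr_le; auto.
    + rewrite !fixed; auto; [|lra]. rewrite <- (s_left q) by lra. apply incr_le; auto. lra.
Qed.

(** The witness [w] is the conjugate of [c] by [u] and also by [v]; in this form the equality of the
    two conjugates needs no symbol for the inverse. *)
Definition conj_eq (u v : R -> R) : Prop :=
  exists w, G w /\ u ** w = c ** u /\ v ** w = c ** v.

Lemma conj_eq_trans u v v' : G u -> conj_eq u v -> conj_eq u v' -> conj_eq v v'.
Proof.
  intros Gu (w & Gw & h1 & h2) (w' & Gw' & h1' & h2').
  assert (e : w = w').
  { apply functional_extensionality. intros z. destruct (G_surj u Gu z) as [y <-].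
    rewrite <- h1' in h1. exact (f_equal (fun h => h y) h1). }
  subst w'. exists w. auto.
Qed.

(** The conjugate of [c] by [T i] moves some point of [T i J], and the conjugate by [T j] moves only
    points of [T j J]; these intervals are disjoint for distinct exponents. *)
Lemma conj_eq_T i j : conj_eq (T i) (T j) -> i = j.
Proof.
  intros (w & Gw & h1 & h2). destruct c_moves as (z & hz & hcz).
  assert (e1 := f_equal (fun h => h z) h1).
  assert (e2 := f_equal (fun h => h (pw t j (T i z))) h2).
  unfold grp_op in e1, e2. rewrite T_pwt, e1 in e2.
  destruct (excluded_middle_informative (J (pw t j (T i z)))) as [hJ|hJ].
  - apply (T_J_disjoint i j z (pw t j (T i z))); auto. rewrite T_pwt. reflexivity.
  - exfalso. rewrite (c_fix _ hJ), T_pwt in e2. apply hcz.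
    apply (G_inj (T i)); auto using G_pw.
Qed.

(** The conjugate by [T k] of [s ** ti], which is the identity from [t p] on and [ti] up to [q].
    Hence it fixes [T j J] pointwise for [j < k] and moves it to [T (S j) J] for [j >= k]. *)
Definition shift k : R -> R := fun x => T k (ti (s (pw t k x))).

Lemma G_shift k : G (shift k).
Proof.
  apply (G_mul (fun x => ti (s (pw t k x))) (T k)); auto using G_pw.
  apply (G_mul (fun x => s (pw t k x)) ti); auto.
  apply (G_mul (pw t k) s); auto using G_pw.
Qed.

Lemma shift_low k j x : J x -> (j < k)%nat -> shift k (T j x) = T j x.
Proof.
  intros hx hj. unfold shift. rewrite s_right, ti_t; [apply T_pwt|].
  replace k with (S (k - j - 1) + j)%nat by lia.
  rewrite pw_add, pwt_T. apply t_ge. lra.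
Qed.

Lemma shift_high k j x : J x -> (k <= j)%nat -> shift k (T j x) = T (S j) x.
Proof.
  intros hx hj. unfold shift.
  replace j with (k + (j - k))%nat at 1 by lia. rewrite pw_add, pwt_T, s_left.
  - change (ti (T (j - k) x)) with (T (S (j - k)) x). rewrite <- pw_add.
    f_equal. lia.
  - apply T_le. lra.
Qed.

Lemma stretch_exists n k :
  exists b, G b /\ forall j x, J x -> b (T j x) = T (j + n * Nat.min j k) x.
Proof.
  induction k as [|k (b & Gb & hb)].
  - exists idR. split; [apply hG|]. intros j x _.
    rewrite Nat.min_0_r, Nat.mul_0_r, Nat.add_0_r. reflexivity.
  (* The [n] applications of [shift (S k)] raise by [n] all indices above [k]; [b] comes afterwards
     and adds [n * k] to these. *)
  - exists (fun x => b (pw (shift (S k)) n x)).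
    split; [apply G_mul; auto using G_pw, G_shift|].
    intros j x hx. destruct (le_lt_dec j k) as [h|h].
    + assert (e : pw (shift (S k)) n (T j x) = T j x).
      { clear hb. induction n as [|n IH]; [reflexivity|].
        rewrite pw_S_r, shift_low; auto; lia. }
      rewrite e, hb by auto. f_equal. f_equal. f_equal. lia.
    + assert (e : pw (shift (S k)) n (T j x) = T (j + n) x).
      { clear hb. revert j h. induction n as [|n IH]; intros j h.
        - rewrite Nat.add_0_r. reflexivity.
        - rewrite pw_S_r, shift_high, IH by (auto; lia). f_equal. lia. }
      rewrite e, hb by auto. f_equal.
      rewrite !Nat.min_r by lia. lia.
Qed.

(** [b] fixes [J] pointwise, by the case [j = 0], so by injectivity it maps the complement into
    itself, where [c] is the identity. *)
Lemma stretch_commute b n k :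
  G b -> (forall j x, J x -> b (T j x) = T (j + n * Nat.min j k) x) -> b ** c = c ** b.
Proof.
  intros Gb hb. assert (b_J : forall x, J x -> b x = x).
  { intros x hx. rewrite (hb 0%nat x hx : b x = _), Nat.mul_0_r. reflexivity. }
  apply functional_extensionality. intros x. unfold grp_op.
  destruct (excluded_middle_informative (J x)) as [h|h].
  - rewrite !b_J; auto using c_J.
  - rewrite (c_fix x h), (c_fix (b x)); auto. intros h'. apply h.
    rewrite <- (G_inj b Gb (b x) x (b_J _ h')). exact h'.
Qed.

(** The common conjugate is [cT (j + n * j)]. On [J] the two conjugators agree; off [J], injectivity
    keeps the image under [T j ** b] outside [T (j + n * j) J]. *)
Lemma stretch_conj b n k j :
  G b -> (forall j x, J x -> b (T j x) = T (j + n * Nat.min j k) x) ->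
  (j <= k)%nat -> conj_eq (T j ** b) (T (j + n * j)).
Proof.
  intros Gb hb hj.
  assert (hb' : forall x, J x -> b (T j x) = T (j + n * j) x).
  { intros x hx. rewrite hb by auto. rewrite Nat.min_l by lia. reflexivity. }
  exists (cT (j + n * j)). split; [apply G_cT|]. split; [|apply cT_T].
  apply functional_extensionality. intros x. unfold grp_op, cT.
  destruct (excluded_middle_informative (J x)) as [h|h].
  - rewrite (hb' x h), pwt_T, hb'; auto using c_J.
  - rewrite (c_fix x h), c_fix; [apply T_pwt|]. intros h'. apply h.
    set (z := pw t (j + n * j) (b (T j x))) in *.
    assert (e : b (T j z) = b (T j x)).
    { rewrite hb' by auto. apply T_pwt. }
    apply G_inj in e; auto. apply G_inj in e; [congruence|auto using G_pw].
Qed.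

(* Writing [x = T k] and [y = T n], the element [b] is to conjugate the copy of [c] on [T j J]
   to that on [T (j + j * n) J] for all [j <= k], and the relation is recovered
   at [j = k]. *)
Definition mul_rel (x y v : R -> R) : Prop :=
  exists b, G b /\ b ** c = c ** b /\
    (forall i, G i -> (exists j, i = T j) -> forall u, G u -> (exists m, u = T m) ->
       (exists e, G e /\ (exists m, e = T m) /\ (i ** e) ** ti = x) ->
       conj_eq (i ** b) u -> conj_eq ((i ** ti) ** b) ((u ** ti) ** y)) /\
    conj_eq (x ** b) (v ** x).

Lemma mul_rel_T k n m : mul_rel (T k) (T n) (T m) <-> (k * n)%nat = m.
Proof.
  split.
  - intros (b & Gb & bc & step & last).
    assert (K : forall j, (j <= k)%nat -> conj_eq (T j ** b) (T (j + n * j))).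
    { induction j as [|j IH]; intros hj.
      - exists c. rewrite Nat.mul_0_r. auto.
      - rewrite <- T_S.
        replace (S j + n * S j)%nat with (S (j + n * j) + n)%nat by lia.
        rewrite <- T_mul, <- T_S.
        apply step; auto using G_pw; eauto.
        (* The clause on [e] in [mul_rel] expresses [j < k], the final [ti] making the inequality
           strict. *)
        + exists (T (k - j - 1)). split; [auto using G_pw|]. split; [eauto|].
          rewrite T_mul, T_S. f_equal. lia.
        + apply IH. lia. }
    (* [T k ** b] conjugates [c] as [T (k + n * k)] does, by the steps, and as [T (m + k)] does, by
       the last clause. *)
    assert (e : (k + n * k = m + k)%nat); [|lia].
    apply conj_eq_T, conj_eq_trans with (T k ** b).
    + apply (G_mul (T k) b); auto using G_pw.
    + auto.
    + rewrite <- T_mul. exact last.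
  - intros <-. destruct (stretch_exists n k) as (b & Gb & hb).
    assert (K := fun j => stretch_conj b n k j Gb hb).
    exists b. split; [auto|]. split; [eapply stretch_commute; eauto|]. split.
    + intros _ _ [j ->] _ _ [m ->] (_ & _ & [e ->] & E) h.
      rewrite T_mul, T_S in E. apply T_inj in E.
      assert (hm : (j + n * j)%nat = m).
      { apply conj_eq_T, conj_eq_trans with (T j ** b); auto.
        - apply (G_mul (T j) b); auto using G_pw.
        - apply K. lia. }
      rewrite !T_S, T_mul.
      replace (S m + n)%nat with (S j + n * S j)%nat by lia. apply K. lia.
    + rewrite T_mul. replace (k * n + k)%nat with (k + n * k)%nat by lia. auto.
Qed.

End Coding.

(** * Translation of arithmetical formulas *)

Definition FAll {F} (v : nat) (phi : formula F) : formula F := FNot (FEx v (FNot phi)).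
Definition FImp {F} (phi psi : formula F) : formula F := FNot (FAnd phi (FNot psi)).

Lemma upd_same {M} (e : nat -> M) v a : upd e v a v = a.
Proof. unfold upd. rewrite Nat.eqb_refl. reflexivity. Qed.

Lemma upd_other {M} (e : nat -> M) v a i : i <> v -> upd e v a i = e i.
Proof. intros h. unfold upd. rewrite (proj2 (Nat.eqb_neq i v) h). reflexivity. Qed.

Lemma sat_FAll {F M} (dom : M -> Prop) (op : F -> M -> M -> M) e v phi :
  sat dom op e (FAll v phi) <-> forall a, dom a -> sat dom op (upd e v a) phi.
Proof.
  simpl. split.
  - intros h a ha. apply NNPP. intros h'. apply h. eauto.
  - intros h (a & ha & h'). auto.
Qed.

Lemma sat_FImp {F M} (dom : M -> Prop) (op : F -> M -> M -> M) e phi psi :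
  sat dom op e (FImp phi psi) <-> (sat dom op e phi -> sat dom op e psi).
Proof. simpl. split; [intros h h1; apply NNPP; tauto | tauto]. Qed.

Lemma ex_dom_iff {M} (dom P Q : M -> Prop) :
  (forall a, dom a -> (P a <-> Q a)) ->
  (exists a, dom a /\ P a) <-> (exists a, dom a /\ Q a).
Proof. firstorder. Qed.

Lemma all_dom_iff {M} (dom P Q : M -> Prop) :
  (forall a, dom a -> (P a <-> Q a)) ->
  (forall a, dom a -> P a) <-> (forall a, dom a -> Q a).
Proof. firstorder. Qed.

Lemma and_iff (A A' B B' : Prop) : (A <-> A') -> (B <-> B') -> (A /\ B <-> A' /\ B').
Proof. tauto. Qed.

Lemma imp_iff (A A' B B' : Prop) :
  (A <-> A') -> (B <-> B') -> ((A -> B) <-> (A' -> B')).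
Proof. tauto. Qed.

Lemma eval_upd_fresh {F M} (op : F -> M -> M -> M) e v a tm :
  ~ term_has_var v tm -> eval_term op (upd e v a) tm = eval_term op e tm.
Proof.
  induction tm as [i | f t1 IH1 t2 IH2]; simpl; intros h.
  - apply upd_other. auto.
  - rewrite IH1, IH2; tauto.
Qed.

Fixpoint term_bound {F} (tm : term F) : nat :=
  match tm with
  | TVar n => S n
  | TApp _ t1 t2 => Nat.max (term_bound t1) (term_bound t2)
  end.

Fixpoint var_bound {F} (phi : formula F) : nat :=
  match phi with
  | FEq t1 t2 => Nat.max (term_bound t1) (term_bound t2)
  | FNot p => var_bound p
  | FAnd p q => Nat.max (var_bound p) (var_bound q)
  | FEx v p => Nat.max (S v) (var_bound p)
  end.

Ltac upd_simpl := repeat (rewrite upd_same || rewrite upd_other by lia).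

Section Translation.

Variables (G : (R -> R) -> Prop) (t ti s c : R -> R).

Local Notation "x ** y" := (grp_op SMul x y) (at level 40, left associativity).
Local Notation T := (pw ti).
Local Notation gsat := (sat G grp_op).

Hypothesis G_id : G idR.
Hypotheses (Gt : G t) (Gti : G ti) (Gs : G s) (Gc : G c).
Hypothesis G_T : forall n, G (T n).
Hypothesis T_add : forall i j, T i ** T j = T (i + j).
Hypothesis T_injective : forall i j, T i = T j -> i = j.
Hypothesis T_def : forall x, G x ->
  ((x ** t = t ** x /\ exists y, G y /\ x ** y = c ** x /\ y ** s = s ** y)
   <-> exists n, x = T n).
Hypothesis mul_def :
  forall k n m, mul_rel G ti c (T k) (T n) (T m) <-> (k * n)%nat = m.

Variable k : nat.

Local Notation V := (@TVar grp_sym).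
Local Notation "x '***' y" := (TApp SMul x y) (at level 40, left associativity).

(** The order is that of the parameter list [[t; c; s; ti]], placed after the [k] entries of the
    tuple. *)
Definition params (e : nat -> R -> R) : Prop :=
  e k = t /\ e (k + 1)%nat = c /\ e (k + 2)%nat = s /\ e (k + 3)%nat = ti.

Lemma params_upd e v a : (v < k \/ k + 4 <= v)%nat -> params e -> params (upd e v a).
Proof. intros hv (h1 & h2 & h3 & h4). unfold params. upd_simpl. auto. Qed.

(** Being a power of [ti], after [T_def]; [N] is a fresh variable for the conjugate of [c]. *)
Definition fpow (x N : nat) : formula grp_sym :=
  FAnd (FEq (V x *** V k) (V k *** V x))
    (FEx N (FAnd (FEq (V x *** V N) (V (k + 1) *** V x))
                 (FEq (V N *** V (k + 2)) (V (k + 2) *** V N)))).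

Lemma sat_fpow e x N :
  params e -> (x < N)%nat -> (k + 4 <= N)%nat -> G (e x) ->
  (gsat e (fpow x N) <-> exists n, e x = T n).
Proof.
  intros (h1 & h2 & h3 & h4) hx hN hG. rewrite <- T_def by exact hG. simpl.
  apply and_iff; [rewrite h1; reflexivity|].
  apply ex_dom_iff. intros a _. upd_simpl. rewrite h2, h3. reflexivity.
Qed.

Lemma free_fpow w x N : is_free w (fpow x N) -> w = x \/ (k <= w < k + 4)%nat.
Proof. simpl. lia. Qed.

Definition fconj (u v : term grp_sym) (N : nat) : formula grp_sym :=
  FEx N (FAnd (FEq (u *** V N) (V (k + 1) *** u)) (FEq (v *** V N) (V (k + 1) *** v))).

Lemma sat_fconj e u v N :
  params e -> (k + 4 <= N)%nat -> ~ term_has_var N u -> ~ term_has_var N v ->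
  (gsat e (fconj u v N) <->
   conj_eq G c (eval_term grp_op e u) (eval_term grp_op e v)).
Proof.
  intros (h1 & h2 & h3 & h4) hN hu hv. simpl. apply ex_dom_iff. intros a _.
  rewrite !eval_upd_fresh by auto. upd_simpl. rewrite h2. reflexivity.
Qed.

Lemma free_fconj w u v N :
  is_free w (fconj u v N) ->
  term_has_var w u \/ term_has_var w v \/ (k <= w < k + 4)%nat.
Proof.
  simpl. intros (h1 & h2).
  assert (N <> w) by auto. intuition lia.
Qed.

(** [mul_rel] as a formula: the variables from [N] to [N + 3] stand for [b], [i], [u], [e], and
    [N + 4] is left to the inner formulas. *)
Definition fmul (x y v N : nat) : formula grp_sym :=
  FEx N (FAnd (FEq (V N *** V (k + 1)) (V (k + 1) *** V N))
    (FAnd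
      (FAll (N + 1) (FImp (fpow (N + 1) (N + 4))
        (FAll (N + 2) (FImp (fpow (N + 2) (N + 4))
          (FImp
            (FEx (N + 3) (FAnd (fpow (N + 3) (N + 4))
              (FEq (V (N + 1) *** V (N + 3) *** V (k + 3)) (V x))))
            (FImp
              (fconj (V (N + 1) *** V N) (V (N + 2)) (N + 4))
              (fconj (V (N + 1) *** V (k + 3) *** V N)
                     (V (N + 2) *** V (k + 3) *** V y) (N + 4))))))))
      (fconj (V x *** V N) (V v *** V x) (N + 4)))).

Lemma sat_fmul e x y v N :
  params e -> (forall i, G (e i)) -> (x < N)%nat -> (y < N)%nat -> (v < N)%nat ->
  (k + 4 <= N)%nat ->
  (gsat e (fmul x y v N) <-> mul_rel G ti c (e x) (e y) (e v)).
Proof.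
  intros hp hG hx hy hv hN. unfold fmul, mul_rel.
  apply ex_dom_iff. intros b hb.
  assert (hp1 : params (upd e N b)) by (apply params_upd; [lia|auto]).
  apply and_iff; [|apply and_iff].
  - destruct hp1 as (_ & h2 & _). simpl. rewrite h2. upd_simpl. reflexivity.
  - rewrite sat_FAll. apply all_dom_iff. intros i hi.
    assert (hp2 : params (upd (upd e N b) (N + 1) i))
      by (apply params_upd; [lia|auto]).
    rewrite sat_FImp. apply imp_iff.
    { rewrite sat_fpow; [|auto|lia|lia|]; upd_simpl; [reflexivity|auto]. }
    rewrite sat_FAll. apply all_dom_iff. intros u hu.
    assert (hp3 : params (upd (upd (upd e N b) (N + 1) i) (N + 2) u))
      by (apply params_upd; [lia|auto]).
    rewrite !sat_FImp. apply imp_iff; [|apply imp_iff; [|apply imp_iff]].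
    + rewrite sat_fpow; [|auto|lia|lia|]; upd_simpl; [reflexivity|auto].
    + apply ex_dom_iff. intros a ha. apply and_iff.
      * rewrite sat_fpow; [|apply params_upd; [lia|auto]|lia|lia|];
          upd_simpl; [reflexivity|auto].
      * destruct hp as (_ & _ & _ & h4). simpl. upd_simpl. rewrite h4. reflexivity.
    + rewrite sat_fconj; [|auto|lia|simpl; lia|simpl; lia].
      simpl. upd_simpl. reflexivity.
    + rewrite sat_fconj; [|auto|lia|simpl; lia|simpl; lia].
      destruct hp as (_ & _ & _ & h4). simpl. upd_simpl. rewrite h4. reflexivity.
  - rewrite sat_fconj; [|auto|lia|simpl; lia|simpl; lia].
    simpl. upd_simpl. reflexivity.
Qed.

Lemma free_fmul w x y v N :
  is_free w (fmul x y v N) -> w = x \/ w = y \/ w = v \/ (k <= w < k + 4)%nat.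
Proof.
  unfold fmul, FAll, FImp. cbn -[fpow fconj]. intros h.
  repeat match goal with
  | H : _ /\ _ |- _ => destruct H
  | H : _ \/ _ |- _ => destruct H
  | H : is_free _ (fpow _ _) |- _ => apply free_fpow in H
  | H : is_free _ (fconj _ _ _) |- _ => apply free_fconj in H; simpl in H
  end; lia.
Qed.

(* The variables [k .. k + 3] hold the parameters. *)
Definition rename (i : nat) : nat := if (i <? k)%nat then i else (i + 4)%nat.

Lemma rename_spec i : (i < k /\ rename i = i \/ k <= i /\ rename i = i + 4)%nat.
Proof. unfold rename. destruct (Nat.ltb_spec i k); auto. Qed.

(** Says that the variable [v] codes the value of [tm]. The values of the two subterms are held in
    [N] and [N + 1], and deeper levels start at [N + 2]. *)
Fixpoint fterm (tm : term arith_sym) (v N : nat) : formula grp_sym :=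
  match tm with
  | TVar i => FEq (V (rename i)) (V v)
  | TApp f t1 t2 =>
      FEx N (FAnd (fpow N (N + 2)) (FEx (N + 1) (FAnd (fpow (N + 1) (N + 2))
        (FAnd (fterm t1 N (N + 2)) (FAnd (fterm t2 (N + 1) (N + 2))
          match f with
          | SPlus => FEq (V N *** V (N + 1)) (V v)
          | STimes => fmul N (N + 1) v (N + 2)
          end)))))
  end.

(** Agreement is required only below [B], so that fresh variables from [B + 4] on can be
    overwritten. *)
Definition codes (B : nat) (e : nat -> R -> R) (ea : nat -> nat) : Prop :=
  params e /\ (forall i, G (e i)) /\ forall i, (i < B)%nat -> e (rename i) = T (ea i).

Lemma codes_upd_fresh B e ea N a :
  (B + 4 <= N)%nat -> (k + 4 <= N)%nat -> G a -> codes B e ea -> codes B (upd e N a) ea.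
Proof.
  intros hN hk ha (h1 & h2 & h3). split; [|split].
  - apply params_upd; auto.
  - intros i. unfold upd. destruct (Nat.eqb i N); auto.
  - intros i hi. destruct (rename_spec i); rewrite upd_other by lia; auto.
Qed.

Lemma codes_upd_rename B e ea i n :
  codes B e ea -> codes B (upd e (rename i) (T n)) (upd ea i n).
Proof.
  intros (h1 & h2 & h3). split; [|split].
  - apply params_upd; auto. destruct (rename_spec i); lia.
  - intros j. unfold upd. destruct (Nat.eqb j (rename i)); auto.
  - intros j hj. destruct (Nat.eq_dec j i) as [->|hne]; upd_simpl; [reflexivity|].
    destruct (rename_spec i); destruct (rename_spec j);
      rewrite (upd_other ea), (upd_other e) by lia; auto.
Qed.

Lemma sat_fterm tm B e ea v N :
  codes B e ea -> (term_bound tm <= B)%nat -> (B + 4 <= N)%nat -> (k + 4 <= N)%nat ->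
  (v < N)%nat -> (exists m, e v = T m) ->
  (gsat e (fterm tm v N) <-> T (eval_term arith_op ea tm) = e v).
Proof.
  revert e v N. induction tm as [i | f t1 IH1 t2 IH2]; intros e v N hc hB hN hk hv hm.
  - simpl in *. destruct hc as (_ & _ & h). rewrite h by lia. reflexivity.
  - simpl in hB. cbn [fterm].
    set (body := match f with SPlus => _ | STimes => _ end).
    assert (key : forall m1 m2,
      let e2 := upd (upd e N (T m1)) (N + 1) (T m2) in
      codes B e2 ea /\
      (gsat e2 body <-> T (arith_op f m1 m2) = e v)).
    { intros m1 m2 e2.
      assert (hc2 : codes B e2 ea).
      { apply codes_upd_fresh; auto; [lia|lia|]. apply codes_upd_fresh; auto. }
      split; [exact hc2|]. destruct hc2 as (hp2 & hG2 & _).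
      destruct hm as [m hm]. unfold body. destruct f.
      - simpl. unfold e2. upd_simpl. rewrite T_add. reflexivity.
      - rewrite sat_fmul by (auto; lia). unfold e2. upd_simpl.
        rewrite hm, mul_def. simpl. split; [congruence|apply T_injective]. }
    assert (hpow : forall e' x, codes B e' ea -> (x < N + 2)%nat ->
              (gsat e' (fpow x (N + 2)) <-> exists n, e' x = T n)).
    { intros e' x (h1 & h2 & _) hx. apply sat_fpow; auto. lia. }
    split.
    + intros (a1 & ha1 & p1 & a2 & ha2 & p2 & s1 & s2 & s3).
      assert (hc1 : codes B (upd e N a1) ea) by (apply codes_upd_fresh; auto).
      assert (hc2 : codes B (upd (upd e N a1) (N + 1) a2) ea)
        by (apply codes_upd_fresh; auto; lia).
      apply hpow in p1; [|auto|lia]. apply hpow in p2; [|auto|lia].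
      rewrite upd_same in p1. rewrite upd_same in p2.
      destruct p1 as [m1 ->]. destruct p2 as [m2 ->].
      apply IH1 in s1; [|auto|lia|lia|lia|lia|upd_simpl; eauto].
      apply IH2 in s2; [|auto|lia|lia|lia|lia|upd_simpl; eauto].
      rewrite upd_other, upd_same in s1 by lia. rewrite upd_same in s2.
      apply T_injective in s1, s2. subst m1 m2. apply key in s3. exact s3.
    + intros E.
      destruct (key (eval_term arith_op ea t1) (eval_term arith_op ea t2)) as [hc2 hb].
      exists (T (eval_term arith_op ea t1)). split; [auto|]. split.
      { apply hpow; [apply codes_upd_fresh; auto|lia|]. upd_simpl. eauto. }
      exists (T (eval_term arith_op ea t2)). split; [auto|]. split.
      { apply hpow; [auto|lia|]. upd_simpl. eauto. }
      split; [|split].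
      * apply IH1; auto; try lia; upd_simpl; eauto.
      * apply IH2; auto; try lia; upd_simpl; eauto.
      * apply hb. exact E.
Qed.

Lemma free_fterm w tm v N :
  is_free w (fterm tm v N) ->
  w = v \/ (k <= w < k + 4)%nat \/ exists i, term_has_var i tm /\ w = rename i.
Proof.
  revert v N. induction tm as [i | f t1 IH1 t2 IH2]; intros v N h.
  - simpl in h. destruct h as [<-|<-]; [right; right; exists i; simpl; auto|auto].
  - assert (hf : is_free w match f with
        | SPlus => FEq (V N *** V (N + 1)) (V v)
        | STimes => fmul N (N + 1) v (N + 2) end ->
        w = N \/ w = (N + 1)%nat \/ w = v \/ (k <= w < k + 4)%nat).
    { destruct f; [simpl; lia|apply free_fmul]. }
    cbn -[fpow fmul] in h.
    destruct h as (n1 & [h|(n2 & [h|[h|[h|h]]])]).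
    + apply free_fpow in h. lia.
    + apply free_fpow in h. lia.
    + apply IH1 in h. destruct h as [h|[h|(i & hi & ->)]]; [lia|auto|].
      right; right. exists i. simpl. auto.
    + apply IH2 in h. destruct h as [h|[h|(i & hi & ->)]]; [lia|auto|].
      right; right. exists i. simpl. auto.
    + apply hf in h. lia.
Qed.

(** Quantifiers are relativized to powers of [ti]. The same [N] serves throughout, as it is taken
    above all renamed variables. *)
Fixpoint translate (N : nat) (phi : formula arith_sym) : formula grp_sym :=
  match phi with
  | FEq t1 t2 => FEx N (FAnd (fpow N (S N)) (FAnd (fterm t1 N (S N)) (fterm t2 N (S N))))
  | FNot p => FNot (translate N p)
  | FAnd p q => FAnd (translate N p) (translate N q)
  | FEx i p => FEx (rename i) (FAnd (fpow (rename i) N) (translate N p))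
  end.

Lemma sat_translate phi B N e ea :
  codes B e ea -> (var_bound phi <= B)%nat -> (B + 4 <= N)%nat -> (k + 4 <= N)%nat ->
  (gsat e (translate N phi) <-> sat (fun _ => True) arith_op ea phi).
Proof.
  revert e ea. induction phi as [t1 t2 | p IH | p IHp q IHq | i p IH];
    intros e ea hc hB hN hk; cbn [var_bound] in hB; cbn [translate sat].
  - assert (hc' : forall a, G a -> codes B (upd e N a) ea)
      by (intros; apply codes_upd_fresh; auto).
    split.
    + intros (a & ha & h & h1 & h2). specialize (hc' a ha).
      apply sat_fpow in h; [|apply hc'|lia|lia|apply hc'].
      apply (sat_fterm t1 B _ ea) in h1; auto; try lia.
      apply (sat_fterm t2 B _ ea) in h2; auto; try lia.
      apply T_injective. congruence.
    + intros E. specialize (hc' (T (eval_term arith_op ea t1)) (G_T _)).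
      assert (h : exists m, upd e N (T (eval_term arith_op ea t1)) N = T m)
        by (upd_simpl; eauto).
      eexists. split; [apply G_T|]. split; [|split].
      * apply sat_fpow; [apply hc'|lia|lia|apply hc'|exact h].
      * apply (sat_fterm t1 B _ ea); auto; try lia. upd_simpl. reflexivity.
      * apply (sat_fterm t2 B _ ea); auto; try lia. upd_simpl. congruence.
  - rewrite (IH e ea) by auto. reflexivity.
  - rewrite (IHp e ea), (IHq e ea) by (auto; lia). reflexivity.
  - assert (hi : (rename i < N)%nat) by (destruct (rename_spec i); lia).
    assert (hpow : forall a, G a ->
              (gsat (upd e (rename i) a) (fpow (rename i) N) <-> exists n, a = T n)).
    { intros a ha. rewrite sat_fpow; auto; upd_simpl; auto; [reflexivity|].
      destruct hc as (hc & _). apply params_upd; auto.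
      destruct (rename_spec i); lia. }
    split.
    + intros (a & ha & h1 & h2). apply hpow in h1; auto. destruct h1 as [n ->].
      exists n. split; [exact I|].
      apply (IH _ (upd ea i n)) in h2; auto; [|lia]. apply codes_upd_rename. exact hc.
    + intros (n & _ & h). exists (T n). split; [auto|].
      split; [apply hpow; eauto|]. apply (IH _ (upd ea i n)); auto; [|lia].
      apply codes_upd_rename. exact hc.
Qed.

Lemma free_translate w N phi :
  is_free w (translate N phi) ->
  (k <= w < k + 4)%nat \/ exists i, is_free i phi /\ w = rename i.
Proof.
  induction phi as [t1 t2 | p IH | p IHp q IHq | i p IH]; cbn [translate is_free].
  - intros (hw & [h|[h|h]]).
    + apply free_fpow in h. lia.
    + apply free_fterm in h. destruct h as [h|[h|(i & hi & ->)]]; [lia|auto|].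
      right. exists i. auto.
    + apply free_fterm in h. destruct h as [h|[h|(i & hi & ->)]]; [lia|auto|].
      right. exists i. auto.
  - exact IH.
  - intros [h|h]; [destruct (IHp h) as [?|(i & ? & ?)] | destruct (IHq h) as [?|(i & ? & ?)]];
      auto; right; exists i; auto.
  - intros (hw & [h|h]); [apply free_fpow in h; lia|].
    destruct (IH h) as [?|(j & hj & ->)]; auto. right. exists j. split; [|auto].
    split; [congruence|auto].
Qed.

(** Restricts the free variables to codes, which the relativized quantifiers do not do. *)
Fixpoint all_powers (N j : nat) : formula grp_sym :=
  match j with
  | O => FEq (V 0) (V 0)
  | S j => FAnd (fpow j N) (all_powers N j)
  end.

Lemma sat_all_powers N e j :
  params e -> (forall i, G (e i)) -> (j <= N)%nat -> (k + 4 <= N)%nat ->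
  (gsat e (all_powers N j) <-> forall i, (i < j)%nat -> exists n, e i = T n).
Proof.
  intros hp hG hj hk. induction j as [|j IH]; cbn [all_powers sat].
  - split; [intros; lia|reflexivity].
  - rewrite IH by lia. rewrite sat_fpow by (auto; lia). split.
    + intros [h1 h2] i hi. destruct (Nat.eq_dec i j) as [->|]; [auto|]. apply h2. lia.
    + intros h. split; [apply h; lia|]. intros i hi. apply h. lia.
Qed.

Lemma free_all_powers w N j : (j <= k)%nat -> is_free w (all_powers N j) -> (w < k + 4)%nat.
Proof.
  induction j as [|j IH]; cbn [all_powers is_free term_has_var]; [lia|].
  intros hj [h|h]; [apply free_fpow in h; lia|apply IH; auto; lia].
Qed.

Lemma powers_list w :
  (forall i, (i < length w)%nat -> exists n, nth i w idR = T n) ->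
  exists ns, w = map T ns.
Proof.
  induction w as [|x w IH]; intros h; [exists nil; reflexivity|].
  destruct IH as [ns ->]; [intros i hi; apply (h (S i)); simpl; lia|].
  destruct (h 0%nat) as [n hn]; [simpl; lia|]. simpl in hn. subst x.
  exists (n :: ns). reflexivity.
Qed.

Lemma definable_translate (X : list nat -> Prop) :
  definable_noparams (fun _ => True) arith_op 0%nat k X ->
  definable_params G grp_op idR k
    (fun w => exists ns, w = map T ns /\ length ns = k /\ X ns).
Proof.
  intros (phi & hfree & hphi).
  set (B := (k + var_bound phi)%nat). set (N := (B + 4)%nat).
  exists (FAnd (all_powers N k) (translate N phi)), [t; c; s; ti].
  split; [repeat constructor; auto|]. split.
  { intros w [h|h]; simpl.
    - apply free_all_powers in h; auto.
    - apply free_translate in h. destruct h as [h|(i & hi & ->)]; [lia|].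
      apply hfree in hi. destruct (rename_spec i); lia. }
  intros w hw hGw. set (e := env_of idR (w ++ [t; c; s; ti])).
  assert (hp : params e).
  { assert (h : forall i, e (k + i)%nat = nth i [t; c; s; ti] idR).
    { intros i. unfold e, env_of. rewrite app_nth2 by lia. f_equal. lia. }
    unfold params. rewrite !h, <- (Nat.add_0_r k), h. auto. }
  assert (hG : forall i, G (e i)).
  { intros i. unfold e, env_of. destruct (Nat.lt_ge_cases i (length (w ++ [t; c; s; ti]))).
    - eapply Forall_forall; [|apply nth_In; eassumption].
      apply Forall_app. split; [auto|]. repeat constructor; auto.
    - rewrite nth_overflow; auto. }
  assert (he : forall i, (i < k)%nat -> e i = nth i w idR).
  { intros i hi. apply app_nth1. lia. }
  assert (main : forall ns, w = map T ns -> length ns = k ->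
            (gsat e (translate N phi) <-> X ns)).
  { intros ns -> hl. rewrite hphi; [|auto|apply Forall_forall; auto].
    apply sat_translate with B; unfold N, B; try lia.
    split; [exact hp|]. split; [exact hG|]. intros i _.
    destruct (rename_spec i) as [[hi ->]|[hi ->]].
    - rewrite he by auto. exact (map_nth T ns 0%nat i).
    (* Variables beyond the tuple are renamed past the parameters, so both sides read defaults, and
       [idR] is [T 0], the code of the default [0]. *)
    - unfold e, env_of. rewrite !nth_overflow;
        [reflexivity|lia|rewrite length_app, length_map; simpl; lia]. }
  cbn [sat]. rewrite sat_all_powers by (auto; unfold N, B; lia). split.
  - intros (ns & E & hl & hX). split; [|apply (main ns); auto].
    intros i hi. rewrite he by auto. exists (nth i ns 0%nat). subst w.
    exact (map_nth T ns 0%nat i).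
  - intros [hpow hsat]. destruct (powers_list w) as [ns E].
    { intros i hi. rewrite <- he by lia. apply hpow. lia. }
    assert (hl : length ns = k) by (rewrite <- hw, E, length_map; reflexivity).
    exists ns. split; [auto|]. split; [auto|]. apply (main ns); auto.
Qed.

End Translation.

(** * The interpretation of arithmetic and the choice of [t], [s], [c] *)

Lemma interprets_nat_of_definable {FN FM N : Type} (domN : N -> Prop)
    (opN : FN -> N -> N -> N) (dN : N) (opM : FM -> nat -> nat -> nat) (T : nat -> N) :
  (forall n, domN (T n)) -> (forall i j, T i = T j -> i = j) ->
  (forall k X, definable_noparams (fun _ => True) opM 0%nat k X ->
     definable_params domN opN dN k
       (fun w => exists ns, w = map T ns /\ length ns = k /\ X ns)) ->
  interprets_with_params domN opN dN (fun _ : nat => True) opM 0%nat.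
Proof.
  intros dom_T T_inj H.
  (* The interpretation has dimension 1 and decodes by inverting [T]; choice picks the exponent,
     which is unique by injectivity. *)
  set (f := fun w : list N => epsilon (inhabits 0%nat) (fun n => w = [T n])).
  assert (f_T : forall n, f [T n] = n).
  { intros n. assert (h : [T n] = [T (f [T n])]).
    { apply (epsilon_spec (inhabits 0%nat) (fun m => [T n] = [T m])). eauto. }
    injection h as h. symmetry. auto. }
  exists 1%nat, (fun w => exists n, w = [T n]), f.
  split; [intros w [n ->]; auto|]. split; [auto|].
  split; [intros n _; exists [T n]; eauto|].
  intros k X hX. rewrite Nat.mul_1_l.
  destruct (H k X hX) as (phi & p & hp & hfree & hphi).
  exists phi, p. split; [exact hp|]. split; [exact hfree|].
  intros w hw hdom. rewrite <- hphi by auto. split.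
  - intros (ws & hl & <- & hD & hXw). exists (map f ws). rewrite length_map.
    split; [|auto]. clear - hD f_T. induction hD as [|w ws [n ->] _ IH]; [reflexivity|].
    simpl. rewrite f_T, IH. reflexivity.
  - intros (ns & -> & hl & hXn). exists (map (fun n => [T n]) ns).
    rewrite length_map, map_map, (map_ext _ _ f_T), map_id.
    split; [exact hl|]. split; [|split; [|exact hXn]].
    + clear. induction ns; simpl; congruence.
    + clear. induction ns; simpl; constructor; eauto.
Qed.

(** A slope other than 1, or its inverse, exceeds 1, and its powers are unbounded. The bound 3 will
    make room for the bumps and give [t a = l * a >= 3 * a]. *)
Lemma large_slope (Lam : R -> Prop) :
  (forall x, Lam x -> 0 < x) -> Lam 1 ->
  (forall x y, Lam x -> Lam y -> Lam (x * y)) -> (forall x, Lam x -> Lam (/ x)) ->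
  (exists x, Lam x /\ x <> 1) -> exists l, Lam l /\ 3 <= l.
Proof.
  intros Lpos L1 Lmul Linv (x & Lx & hx).
  assert (h : exists y, Lam y /\ 1 < y).
  { assert (hx0 := Lpos x Lx). destruct (Rlt_dec 1 x) as [h|h]; [eauto|].
    exists (/ x). split; [auto|]. rewrite <- Rinv_1. apply Rinv_lt_contravar; lra. }
  destruct h as (y & Ly & hy).
  destruct (power_between y 3 hy) as (n & [hn|hn]); [lra| |].
  - exists (y * y ^ n). split; [|lra].
    induction n; simpl; [auto|]. apply Lmul; auto. clear - Lmul Ly L1.
    induction n; simpl; auto.
  - exists y. split; [auto|]. assert (1 <= y ^ n) by (apply pow_R1_Rle; lra). lra.
Qed.

Theorem theoremA
  (r : R) (Lam A : R -> Prop) (G : (R -> R) -> Prop)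
  (hr : 0 < r)
  (hLpos : forall l, Lam l -> 0 < l)
  (hL1 : Lam 1)
  (hLmul : forall l m, Lam l -> Lam m -> Lam (l * m))
  (hLinv : forall l, Lam l -> Lam (/ l))
  (hLnontriv : exists l, Lam l /\ l <> 1)
  (hA0 : A 0)
  (hAadd : forall a b, A a -> A b -> A (a + b))
  (hAopp : forall a, A a -> A (- a))
  (hAr : A r)
  (hLA : forall l a, Lam l -> A a -> A (l * a))
  (hG : is_subgroup_of_V r G)
  (hGF : forall x, (G x /\ isF r allPos allR x) <-> isF r Lam A x) :
  interprets_with_params G grp_op idR (fun _ : nat => True) arith_op 0%nat.
Proof.
  destruct (large_slope Lam hLpos hL1 hLmul hLinv hLnontriv) as (l & Ll & hl3).
  assert (hl : 1 < l) by lra.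
  (* [al] and [be] are multiples of [r] by elements of [Lam], hence in [A]. The first piece of [t]
     ends at [a], and [c] will be a bump of size [be] on [[a, 2 * a]]. *)
  set (al := / l ^ 3 * r). set (a := (l + 1) * al). set (be := / l ^ 2 * al).
  assert (hal : 0 < al).
  { apply Rmult_lt_0_compat; auto. apply Rinv_0_lt_compat, pow_lt. lra. }
  assert (hroom : 3 * l ^ 2 * al <= r).
  { assert (E : l * (l ^ 2 * al) = r) by (unfold al; field; lra).
    assert (0 < l ^ 2 * al) by (apply Rmult_lt_0_compat; nra). nra. }
  destruct (inv_sq l hl) as [hi hi2].
  assert (hbe : 0 < be) by (apply Rmult_lt_0_compat; lra).
  assert (hal_be : l ^ 2 * be = al) by (unfold be; field; lra).
  assert (LA : forall m n x, Lam m -> A x -> A ((m ^ n) * x)).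
  { intros m n x Lm Ax. induction n as [|n IH]; simpl; [rewrite Rmult_1_l; auto|].
    rewrite Rmult_assoc. auto. }
  assert (Aal : A al) by (unfold al; rewrite <- pow_inv; auto).
  assert (Abe : A be) by (unfold be; rewrite <- pow_inv; auto).
  assert (Aa : A a) by (unfold a; rewrite Rmult_plus_distr_r, Rmult_1_l; auto).
  assert (A2a : A (2 * a)) by (replace (2 * a) with (a + a) by ring; auto).
  destruct (breaks_order l r al hl hal hroom) as (ha & hdl & hab & hbr).
  fold a in ha, hab.
  assert (hdl_a : (l ^ 2 - 1) * al = (l - 1) * a) by (unfold a; ring).
  assert (room_s : (l ^ 2 + l + 1) * al <= r - 2 * a).
  { assert (h : l ^ 2 + l + 1 + 2 * (l + 1) <= 3 * l ^ 2) by nra.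
    apply (Rmult_le_compat_r al) in h; [|lra]. unfold a. lra. }
  assert (h2a : 2 * a <= r).
  { assert (0 < (l ^ 2 + l + 1) * al) by (apply Rmult_lt_0_compat; nra). lra. }
  assert (room_c : (l ^ 2 + l + 1) * be <= 2 * a - a).
  { unfold a. rewrite <- hal_be.
    assert (h : l ^ 2 + l + 1 <= (l + 1) * l ^ 2) by nra.
    apply (Rmult_le_compat_r be) in h; lra. }
  assert (room_t := room_bump l r al hl hal hroom).
  assert (Gbump : forall u v x, 0 < x -> (l ^ 2 + l + 1) * x <= v - u ->
            A u -> A v -> A x -> 0 <= u -> v <= r -> G (bump l u v x)).
  { intros. apply hGF. apply bump_isF; auto. }
  set (t := bump l 0 r al). set (s := bump l (2 * a) r al). set (c := bump l a (2 * a) be).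
  assert (Gt : G t) by (apply Gbump; auto; lra).
  assert (Gs : G s) by (apply Gbump; auto; lra).
  assert (Gc : G c) by (apply Gbump; auto; lra).
  assert (incr : forall u v x, forall y z, y < z -> bump l u v x y < bump l u v x z).
  { intros u v x. destruct (bump_inverse_pair l u v x hl) as (h' & h & _). exact h. }
  destruct (proj2 (proj2 (proj2 hG)) t Gt) as (ti & Gti & e1 & e2).
  assert (ti_t : forall x, ti (t x) = x) by exact (fun x => f_equal (fun h => h x) e1).
  assert (t_ti : forall x, t (ti x) = x) by exact (fun x => f_equal (fun h => h x) e2).
  assert (ta : t a = l * a) by (apply t_left; auto; fold a; lra).
  assert (hpq : a < 2 * a) by lra.
  assert (hqt : 2 * a <= t a) by (rewrite ta; nra).
  assert (c_left : forall x, x <= a -> c x = x) by (intros; apply bump_left; auto).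
  assert (c_right : forall x, 2 * a <= x -> c x = x) by (intros; apply bump_right; auto).
  assert (c_moves : exists x, a < x < 2 * a /\ c x <> x).
  { exists (a + be). assert (be < a) by nra. split; [lra|].
    unfold c. rewrite bump_slope_l; auto; nra. }
  assert (s_left : forall x, x <= 2 * a -> s x = x) by (intros; apply bump_left; auto).
  (* The first piece of [s] ends at [3 * a], not after [t a]. From there on [s] and [t] have the
     same translation and the same last piece, being built with the same [r] and [al]. *)
  assert (s_right : forall x, t a <= x -> s x = t x).
  { intros x hx. rewrite ta in hx. assert (3 * a <= l * a) by nra.
    unfold s, t. destruct (Rle_dec x (r - l ^ 2 * al)).
    - rewrite !bump_translation; auto; fold a; lra.
    - destruct (Rle_dec x r).
      + rewrite !bump_slope_r; auto; lra.
      + rewrite !bump_right; auto; lra. }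
  assert (t_central : forall g, G g -> (forall x, g (t x) = t (g x)) ->
            exists n, (forall x, g x = pw t n x) \/ (forall x, g x = pw ti n x)).
  { intros g Gg gt.
    exact (centralizer_cyclic l r al hl hal hroom G ti g hG Gt Gti ti_t t_ti Gg gt). }
  assert (T_inj : forall i j, pw ti i = pw ti j -> i = j) by
    (intros i j; eapply T_inj with (r := r) (G := G) (t := t); eauto).
  assert (G_T : forall n, G (pw ti n)) by (intros n; exact (G_pw r G hG ti n Gti)).
  apply (interprets_nat_of_definable G grp_op idR arith_op (pw ti) G_T T_inj).
  intros k X hX. apply definable_translate with t s c; auto.
  - apply hG.
  - apply T_mul.
  - intros x Gx. eapply T_definable; eauto.
  - intros i n m. eapply mul_rel_T with (t := t) (s := s); eauto.
Qed.
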